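(* Let $\mathcal M$ be a (left) GV-module category over a GV-category $\mathcal C$. Then $\mathcal M$ is algebraic if and only if the subcategory $\widehat{\mathcal M}^{\otimes}$ of $\mathcal M$ contains a $\mathcal C$-generator (and is thus in particular not zero). If in addition $\mathcal C$ and $\mathcal M$ are finite abelian, then the objects $m\in\mathcal M$ for which $\mathrm{mod}\text{-}\underline{\mathrm{Hom}}(m,m)$ is equivalent to $\mathcal M$ as a $(\mathcal C,\otimes)$-module category are precisely the $\mathcal C$-generators in $\widehat{\mathcal M}^{\otimes}$, while the objects $n\in\mathcal M$ for which $\mathrm{comod}\text{-}\underline{\mathrm{coHom}}(n,n)$ is equivalent to $\mathcal M$ as a $(\mathcal C,\odot)$-module category are precisely the $\mathcal C$-cogenerators in $\widehat{\mathcal M}^{\odot}$.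
   Context: A finite category is a linear category over a field $\Bbbk$ equivalent, as an abelian category, to the category of finite-dimensional modules over a finite-dimensional $\Bbbk$-algebra. A GV-category is a monoidal category $(\mathcal C,\otimes,1)$ with a chosen dualizing object $K$: for every $y$ the functor $x\mapsto\mathrm{Hom}(x\otimes y,K)$ is represented by an object $Gy$, and the resulting contravariant functor $G$ is an anti-equivalence. The second tensor product is $x\odot y:=G^{-1}(Gy\otimes Gx)$, with unit $K$. A left GV-module category is a left module category $(\mathcal M,\triangleright)$ over $(\mathcal C,\otimes)$ such that all functors $c\triangleright{-}$ and ${-}\triangleright m$ have right adjoints. Let $c\blacktriangleright{-}$ be a fixed right adjoint of $Gc\triangleright{-}$; $\blacktriangleright$ is an action of $(\mathcal C,\odot)$. Internal Hom and coHom: $\mathrm{Hom}_{\mathcal M}(c\triangleright m,n)\cong\mathrm{Hom}_{\mathcal C}(c,\underline{\mathrm{Hom}}(m,n))$ and $\mathrm{Hom}_{\mathcal M}(n,c\blacktriangleright m)\cong\mathrm{Hom}_{\mathcal C}(\underline{\mathrm{coHom}}(m,n),c)$. $\underline{\mathrm{Hom}}(m,m)$ is an algebra in $(\mathcal C,\otimes,1)$ via the internal composition, and $\underline{\mathrm{coHom}}(m,m)$ is a coalgebra in $(\mathcal C,\odot,K)$ via the internal cocomposition. $\mathrm{mod}\text{-}A$ is the category of right $A$-modules in $(\mathcal C,\otimes)$, with left action $c\otimes{-}$; $\mathrm{comod}\text{-}C$ is the category of right $C$-comodules in $(\mathcal C,\odot)$, with left action $c\odot{-}$. $\mathcal M$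 is called algebraic if it is equivalent to a GV-module category of the form $\mathrm{mod}\text{-}A$ for some algebra $A$ in $(\mathcal C,\otimes,1)$. $\underline{\mathrm{Hom}}(m,-)$ has a lax $\triangleright$-module structure $c\otimes\underline{\mathrm{Hom}}(m,n)\to\underline{\mathrm{Hom}}(m,c\triangleright n)$ (adjunct to the action of $c$ on the evaluation $\underline{\mathrm{Hom}}(m,n)\triangleright m\to n$), and dually $\underline{\mathrm{coHom}}(m,-)$ has an oplax $\blacktriangleright$-module structure $\underline{\mathrm{coHom}}(m,c\blacktriangleright n)\to c\odot\underline{\mathrm{coHom}}(m,n)$. $\widehat{\mathcal M}^{\otimes}$ is the full subcategory of objects $m$ for which $\underline{\mathrm{Hom}}(m,-)\colon\mathcal M\to\mathcal C$ is a strong $\triangleright$-module functor and has a right adjoint; $\widehat{\mathcal M}^{\odot}$ is the full subcategory of objects $m$ for which $\underline{\mathrm{coHom}}(m,-)\colon\mathcal M\to\mathcal C$ is a strong $\blacktriangleright$-module functor and has a left adjoint. A $\mathcal C$-generator of $\mathcal M$ is an object $m_0\in\mathcal M$ such that for every $m\in\mathcal M$ there are $c\in\mathcal C$ and an epimorphism $c\triangleright m_0\to m$; a $\mathcal C$-cogenerator is an object $n_0\in\mathcal M$ such that for every $m\in\mathcal M$ there are $d\in\mathcal C$ and a monomorphism $m\to d\blacktriangleright n_0$.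
   Formalization: That a generator in the subcategory makes M algebraic is claimed for abelian M; ''not zero'' is claimed when M has a nonzero object; in the second part ''equivalent'' means that the canonical functor Hom(m,-), resp. coHom(n,-), is an equivalence of module categories. *)

(* Defs.v *)
From mathcomp Require Import all_boot all_algebra.
From Stdlib Require Import ProofIrrelevance.

Set Implicit Arguments.
Unset Strict Implicit.
Unset Printing Implicit Defensive.
Set Primitive Projections.

Declare Scope cat_scope.
Delimit Scope cat_scope with cat.
Local Open Scope cat_scope.

Record Cat := {
  ob :> Type;
  hom : ob -> ob -> Type;
  idm : forall x, hom x x;
  comp : forall x y z, hom y z -> hom x y -> hom x z;
  compA : forall x y z w (h : hom z w) (g : hom y z) (f : hom x y),
    comp h (comp g f) = comp (comp h g) f;
  comp1m : forall x y (f : hom x y), comp (idm y) f = f;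
  compm1 : forall x y (f : hom x y), comp f (idm x) = f }.

Arguments hom {c} x y : rename.
Arguments idm {c} x : rename.
Arguments comp {c x y z} g f : rename.
Notation "g ∘ f" := (comp g f) (at level 40, left associativity) : cat_scope.

Definition is_iso (C : Cat) (x y : C) (f : hom x y) : Prop :=
  exists g : hom y x, g ∘ f = idm x /\ f ∘ g = idm y.

Definition is_mono (C : Cat) (x y : C) (f : hom x y) : Prop :=
  forall z (g h : hom z x), f ∘ g = f ∘ h -> g = h.

Definition is_epi (C : Cat) (x y : C) (f : hom x y) : Prop :=
  forall z (g h : hom y z), g ∘ f = h ∘ f -> g = h.

Record Iso (C : Cat) (x y : C) := {
  fwd :> hom x y;
  bwd : hom y x;
  bwdK : bwd ∘ fwd = idm x;
  fwdK : fwd ∘ bwd = idm y }.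

Definition iso_inv (C : Cat) (x y : C) (f : Iso x y) : Iso y x :=
  {| fwd := bwd f; bwd := fwd f; bwdK := fwdK f; fwdK := bwdK f |}.

Record Functor (C D : Cat) := {
  fob :> C -> D;
  fmap : forall x y, hom x y -> hom (fob x) (fob y);
  fmap1 : forall x, fmap (idm x) = idm (fob x);
  fmapD : forall x y z (g : hom y z) (f : hom x y),
    fmap (g ∘ f) = fmap g ∘ fmap f }.

Arguments fmap {C D} f {x y} _ : rename.

Definition idF (C : Cat) : Functor C C :=
  {| fob := fun x => x; fmap := fun x y f => f;
     fmap1 := fun x => erefl; fmapD := fun x y z g f => erefl |}.

Lemma compF_id C D E (G : Functor D E) (F : Functor C D) x :
  fmap G (fmap F (idm x)) = idm (G (F x)).
Proof. by rewrite !fmap1. Qed.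

Lemma compF_comp C D E (G : Functor D E) (F : Functor C D) x y z
    (g : hom y z) (f : hom x y) :
  fmap G (fmap F (g ∘ f)) = fmap G (fmap F g) ∘ fmap G (fmap F f).
Proof. by rewrite !fmapD. Qed.

Definition compF C D E (G : Functor D E) (F : Functor C D) : Functor C E :=
  {| fob := fun x => G (F x); fmap := fun x y f => fmap G (fmap F f);
     fmap1 := @compF_id C D E G F; fmapD := @compF_comp C D E G F |}.

Record NatIso C D (F G : Functor C D) := {
  ncomp :> forall x, Iso (F x) (G x);
  nnat : forall x y (f : hom x y), ncomp y ∘ fmap F f = fmap G f ∘ ncomp x }.

Record Equivalence C D (F : Functor C D) := {
  qinv : Functor D C;
  eunit : NatIso (idF C) (compF qinv F);
  ecounit : NatIso (compF F qinv) (idF D) }.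

Definition is_equivalence C D (F : Functor C D) : Prop := inhabited (Equivalence F).

Definition opCat (C : Cat) : Cat :=
  {| ob := ob C; hom := fun x y => @hom C y x; idm := fun x => @idm C x;
     comp := fun x y z g f => @comp C z y x f g;
     compA := fun x y z w h g f => esym (@compA C w z y x f g h);
     comp1m := fun x y f => @compm1 C y x f;
     compm1 := fun x y f => @comp1m C y x f |}.

Definition opFun C D (F : Functor C D) : Functor (opCat C) (opCat D) :=
  {| fob := F : opCat C -> opCat D; fmap := fun x y f => @fmap C D F y x f;
     fmap1 := fun x => fmap1 F x;
     fmapD := fun x y z g f => @fmapD C D F z y x f g |}.

(** A right adjoint is given by a universal arrow [counit d] from [F] to each
    object [d]; this amounts to a natural bijection
    [Hom (F c) d ~ Hom c (radj d)]. *)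
Record RightAdjoint C D (F : Functor C D) := {
  radj :> D -> C;
  counit : forall d, hom (F (radj d)) d;
  lift : forall c d, hom (F c) d -> hom c (radj d);
  counit_lift : forall c d (f : hom (F c) d), counit d ∘ fmap F (lift f) = f;
  lift_counit : forall c d (g : hom c (radj d)), lift (counit d ∘ fmap F g) = g }.

Definition has_right_adjoint C D (F : Functor C D) : Prop := inhabited (RightAdjoint F).

(** [ladj] is left adjoint to [F] iff it is right adjoint to [opFun F]. *)
Definition LeftAdjoint C D (F : Functor C D) := RightAdjoint (opFun F).

Definition has_left_adjoint C D (F : Functor C D) : Prop := inhabited (LeftAdjoint F).

Section RightAdjointFacts.
Context {C D : Cat} {F : Functor C D} (R : RightAdjoint F).

Lemma lift_inj c d (g g' : hom c (R d)) :
  counit R d ∘ fmap F g = counit R d ∘ fmap F g' -> g = g'.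
Proof. by move=> E; rewrite -(lift_counit g) -(lift_counit g') E. Qed.

Definition radj_map d d' (f : hom d d') : hom (R d) (R d') :=
  lift R (f ∘ counit R d).

Lemma radj_map1 d : radj_map (idm d) = idm (R d).
Proof. by apply: lift_inj; rewrite counit_lift fmap1 comp1m compm1. Qed.

Lemma radj_mapD x y z (g : hom y z) (f : hom x y) :
  radj_map (g ∘ f) = radj_map g ∘ radj_map f.
Proof.
apply: lift_inj; rewrite counit_lift fmapD compA counit_lift.
by rewrite -!compA counit_lift.
Qed.

Definition radjF : Functor D C :=
  {| fob := radj R; fmap := radj_map; fmap1 := radj_map1; fmapD := radj_mapD |}.
End RightAdjointFacts.

(** Freyd's axioms; the additive structure is then determined by the category. *)

Section Abelian.
Context (C : Cat).

Definition is_initial (z : C) : Prop := forall x, exists! f : hom z x, True.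
Definition is_terminal (z : C) : Prop := forall x, exists! f : hom x z, True.
Definition is_zero (z : C) : Prop := is_initial z /\ is_terminal z.

Definition zero_mor (x y : C) (f : hom x y) : Prop :=
  exists (z : C) (g : hom z y) (h : hom x z), is_zero z /\ f = g ∘ h.

Definition is_product (x y p : C) (p1 : hom p x) (p2 : hom p y) : Prop :=
  forall (t : C) (f : hom t x) (g : hom t y),
  exists! h : hom t p, p1 ∘ h = f /\ p2 ∘ h = g.

Definition is_coproduct (x y s : C) (i1 : hom x s) (i2 : hom y s) : Prop :=
  forall (t : C) (f : hom x t) (g : hom y t),
  exists! h : hom s t, h ∘ i1 = f /\ h ∘ i2 = g.

Definition is_kernel (x y n : C) (f : hom x y) (k : hom n x) : Prop :=
  zero_mor (f ∘ k) /\
  forall (t : C) (g : hom t x), zero_mor (f ∘ g) -> exists! h : hom t n, k ∘ h = g.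

Definition is_cokernel (x y q : C) (f : hom x y) (p : hom y q) : Prop :=
  zero_mor (p ∘ f) /\
  forall (t : C) (g : hom y t), zero_mor (g ∘ f) -> exists! h : hom q t, h ∘ p = g.

Record is_abelian : Prop := {
  ab_zero : exists z : C, is_zero z;
  ab_prod : forall x y : C, exists p (p1 : hom p x) (p2 : hom p y), is_product p1 p2;
  ab_coprod : forall x y : C, exists s (i1 : hom x s) (i2 : hom y s), is_coproduct i1 i2;
  ab_ker : forall (x y : C) (f : hom x y), exists n (k : hom n x), is_kernel f k;
  ab_coker : forall (x y : C) (f : hom x y), exists q (p : hom y q), is_cokernel f p;
  ab_mono : forall (n x : C) (k : hom n x), is_mono k ->
    exists y (f : hom x y), is_kernel f k;
  ab_epi : forall (y q : C) (p : hom y q), is_epi p ->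
    exists x (f : hom x y), is_cokernel f p }.
End Abelian.

Section Finite.
Local Open Scope ring_scope.
Import GRing.Theory.
Context (k : fieldType).

Record Linear (C : Cat) := {
  hzero : forall x y : C, hom x y;
  hopp : forall x y : C, hom x y -> hom x y;
  hadd : forall x y : C, hom x y -> hom x y -> hom x y;
  hscale : forall x y : C, k -> hom x y -> hom x y;
  haddA : forall x y : C, associative (@hadd x y);
  haddC : forall x y : C, commutative (@hadd x y);
  hadd0 : forall x y : C, left_id (hzero x y) (@hadd x y);
  haddN : forall x y : C, left_inverse (hzero x y) (@hopp x y) (@hadd x y);
  hscaleA : forall (x y : C) a b (f : hom x y), hscale a (hscale b f) = hscale (a * b) f;
  hscale1 : forall (x y : C) (f : hom x y), hscale 1 f = f;
  hscaleDl : forall (x y : C) a b (f : hom x y),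
    hscale (a + b) f = hadd (hscale a f) (hscale b f);
  hscaleDr : forall (x y : C) a (f g : hom x y),
    hscale a (hadd f g) = hadd (hscale a f) (hscale a g);
  hcompDl : forall (x y z : C) (g g' : hom y z) (f : hom x y),
    (hadd g g' ∘ f)%cat = hadd (g ∘ f)%cat (g' ∘ f)%cat;
  hcompDr : forall (x y z : C) (g : hom y z) (f f' : hom x y),
    (g ∘ hadd f f')%cat = hadd (g ∘ f)%cat (g ∘ f')%cat;
  hcompZl : forall (x y z : C) a (g : hom y z) (f : hom x y),
    (hscale a g ∘ f)%cat = hscale a (g ∘ f)%cat;
  hcompZr : forall (x y z : C) a (g : hom y z) (f : hom x y),
    (g ∘ hscale a f)%cat = hscale a (g ∘ f)%cat }.

(** MathComp's [falgType] excludes the zero algebra, whose module category is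
    the zero category; hence this record. *)
Record FDAlgebra := {
  fda :> vectType k;
  fmul : fda -> fda -> fda;
  fone : fda;
  fmulA : associative fmul;
  fmul1 : left_id fone fmul;
  fmulr1 : right_id fone fmul;
  fmul_linl : forall c a b x, fmul (c *: a + b) x = c *: fmul a x + fmul b x;
  fmul_linr : forall c a x y, fmul a (c *: x + y) = c *: fmul a x + fmul a y }.

Record FDModule (A : FDAlgebra) := {
  fdm :> vectType k;
  fact : A -> fdm -> fdm;
  factA : forall a b v, fact a (fact b v) = fact (fmul a b) v;
  fact1 : forall v, fact (fone A) v = v;
  fact_linl : forall c a b v, fact (c *: a + b) v = c *: fact a v + fact b v;
  fact_linr : forall c a v w, fact a (c *: v + w) = c *: fact a v + fact a w }.

Definition fd_equivariant (A : FDAlgebra) (V W : FDModule A) (f : 'Hom(V, W)) : Prop :=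
  forall a v, f (fact a v) = fact a (f v).

Definition fd_hom (A : FDAlgebra) (V W : FDModule A) :=
  {f : 'Hom(V, W) | fd_equivariant f}.

Lemma fd_hom_inj (A : FDAlgebra) (V W : FDModule A) (f g : fd_hom V W) :
  sval f = sval g -> f = g.
Proof.
case: f g => [f Hf] [g Hg] /= E; case: g / E Hg => Hg.
by rewrite (proof_irrelevance _ Hf Hg).
Qed.

Lemma fd_id_subproof (A : FDAlgebra) (V : FDModule A) :
  fd_equivariant (\1%VF : 'Hom(V, V)).
Proof. by move=> a v; rewrite !id_lfunE. Qed.

Lemma fd_comp_subproof (A : FDAlgebra) (U V W : FDModule A)
    (g : fd_hom V W) (f : fd_hom U V) : fd_equivariant (sval g \o sval f)%VF.
Proof. by case: g f => [g Hg] [f Hf] a v; rewrite !comp_lfunE /= Hf Hg. Qed.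

Definition fd_id (A : FDAlgebra) (V : FDModule A) : fd_hom V V :=
  exist _ _ (@fd_id_subproof A V).
Definition fd_comp (A : FDAlgebra) (U V W : FDModule A)
  (g : fd_hom V W) (f : fd_hom U V) : fd_hom U W := exist _ _ (fd_comp_subproof g f).

Lemma fd_compA (A : FDAlgebra) (x y z w : FDModule A) (h : fd_hom z w) (g : fd_hom y z)
  (f : fd_hom x y) : fd_comp h (fd_comp g f) = fd_comp (fd_comp h g) f.
Proof. by apply: fd_hom_inj; rewrite /= comp_lfunA. Qed.

Lemma fd_comp1m (A : FDAlgebra) (x y : FDModule A) (f : fd_hom x y) :
  fd_comp (fd_id y) f = f.
Proof. by apply: fd_hom_inj; rewrite /= comp_lfun1l. Qed.

Lemma fd_compm1 (A : FDAlgebra) (x y : FDModule A) (f : fd_hom x y) :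
  fd_comp f (fd_id x) = f.
Proof. by apply: fd_hom_inj; rewrite /= comp_lfun1r. Qed.

Definition fdModCat (A : FDAlgebra) : Cat :=
  {| ob := FDModule A; hom := @fd_hom A; idm := @fd_id A; comp := @fd_comp A;
     compA := @fd_compA A; comp1m := @fd_comp1m A; compm1 := @fd_compm1 A |}.

(** [L] is unique once the equivalence [F] is given: it is transported along [F]. *)
Definition is_finite (C : Cat) : Prop :=
  exists (L : Linear C) (A : FDAlgebra) (F : Functor C (fdModCat A)),
    is_equivalence F /\
    forall (x y : C) a (f g : hom x y),
      sval (fmap F (hadd L (hscale L a f) g))
      = a *: sval (fmap F f : fd_hom (F x) (F y)) + sval (fmap F g : fd_hom (F x) (F y)).
End Finite.

Record Monoidal (C : Cat) := {
  tens : C -> C -> C;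
  unit : C;
  tensm : forall a a' b b', hom a a' -> hom b b' -> hom (tens a b) (tens a' b');
  tensm1 : forall a b, tensm (idm a) (idm b) = idm (tens a b);
  tensmD : forall a a' a'' b b' b'' (f' : hom a' a'') (g' : hom b' b'')
    (f : hom a a') (g : hom b b'),
    tensm (f' ∘ f) (g' ∘ g) = tensm f' g' ∘ tensm f g;
  assoc : forall a b c, Iso (tens (tens a b) c) (tens a (tens b c));
  lunit : forall a, Iso (tens unit a) a;
  runit : forall a, Iso (tens a unit) a;
  assoc_nat : forall a b c a' b' c' (f : hom a a') (g : hom b b') (h : hom c c'),
    assoc a' b' c' ∘ tensm (tensm f g) h = tensm f (tensm g h) ∘ assoc a b c;
  lunit_nat : forall a a' (f : hom a a'), lunit a' ∘ tensm (idm unit) f = f ∘ lunit a;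
  runit_nat : forall a a' (f : hom a a'), runit a' ∘ tensm f (idm unit) = f ∘ runit a;
  pentagon : forall a b c d,
    assoc a b (tens c d) ∘ assoc (tens a b) c d =
    tensm (idm a) (assoc b c d) ∘ assoc a (tens b c) d ∘ tensm (assoc a b c) (idm d);
  triangle : forall a b,
    tensm (idm a) (lunit b) ∘ assoc a unit b = tensm (runit a) (idm b) }.

Arguments tensm {C} m {a a' b b'} f g : rename.
Arguments assoc {C} m a b c : rename.
Notation "a ⊗[ V ] b" := (tens V a b)
  (at level 40, left associativity, format "a  ⊗[ V ]  b") : cat_scope.
Notation "f ⊠[ V ] g" := (tensm V f g)
  (at level 38, left associativity, format "f  ⊠[ V ]  g") : cat_scope.

Record Action (C : Cat) (V : Monoidal C) (M : Cat) := {
  act : C -> M -> M;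
  actm : forall c c' m m', hom c c' -> hom m m' -> hom (act c m) (act c' m');
  actm1 : forall c m, actm (idm c) (idm m) = idm (act c m);
  actmD : forall c c' c'' m m' m'' (f' : hom c' c'') (g' : hom m' m'')
    (f : hom c c') (g : hom m m'),
    actm (f' ∘ f) (g' ∘ g) = actm f' g' ∘ actm f g;
  aassoc : forall c d m, Iso (act (c ⊗[V] d) m) (act c (act d m));
  aunit : forall m, Iso (act (unit V) m) m;
  aassoc_nat : forall c d m c' d' m' (f : hom c c') (g : hom d d') (h : hom m m'),
    aassoc c' d' m' ∘ actm (f ⊠[V] g) h = actm f (actm g h) ∘ aassoc c d m;
  aunit_nat : forall m m' (h : hom m m'),
    aunit m' ∘ actm (idm (unit V)) h = h ∘ aunit m;
  apentagon : forall b c d m,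
    aassoc b c (act d m) ∘ aassoc (b ⊗[V] c) d m =
    actm (idm b) (aassoc c d m) ∘ aassoc b (c ⊗[V] d) m ∘ actm (assoc V b c d) (idm m);
  atriangle : forall c m,
    actm (idm c) (aunit m) ∘ aassoc c (unit V) m = actm (runit V c) (idm m) }.

Arguments actm {C V M} a {c c' m m'} f g : rename.
Arguments aassoc {C V M} a c d m : rename.
Arguments aunit {C V M} a m : rename.
Notation "c ▷[ a ] m" := (act a c m)
  (at level 41, right associativity, format "c  ▷[ a ]  m") : cat_scope.

Lemma pre2 (C : Cat) (x y z w : C) (g : hom y z) (f : hom x y) (r : hom x z)
    (h : hom z w) : g ∘ f = r -> h ∘ g ∘ f = h ∘ r.
Proof. by move=> <-; rewrite compA. Qed.

Lemma pre3 (C : Cat) (x y y' z w : C) (g' : hom y' z) (g : hom y y') (f : hom x y)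
    (r : hom x z) (h : hom z w) : g' ∘ g ∘ f = r -> h ∘ g' ∘ g ∘ f = h ∘ r.
Proof. by move=> <-; rewrite !compA. Qed.

Lemma iso_monic (C : Cat) (x y z : C) (i : Iso y z) (f g : hom x y) :
  i ∘ f = i ∘ g -> f = g.
Proof. by move=> E; rewrite -[f]comp1m -[g]comp1m -(bwdK i) -!compA E. Qed.

Lemma iso_epic (C : Cat) (x y z : C) (i : Iso x y) (f g : hom y z) :
  f ∘ i = g ∘ i -> f = g.
Proof. by move=> E; rewrite -[f]compm1 -[g]compm1 -(fwdK i) !compA E. Qed.

Lemma iso_sq (C : Cat) (x y x' y' : C) (i : Iso x y) (i' : Iso x' y')
    (f : hom x x') (g : hom y y') :
  i' ∘ f = g ∘ i -> bwd i' ∘ g = f ∘ bwd i.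
Proof.
move=> E; apply: (@iso_epic _ _ _ _ i); apply: (@iso_monic _ _ _ _ i').
by rewrite -!compA bwdK compm1 [in LHS]compA fwdK comp1m E.
Qed.

Lemma iso_compK (C : Cat) (x y z : C) (g : Iso y z) (f : Iso x y) :
  (bwd f ∘ bwd g) ∘ (g ∘ f) = idm x.
Proof. by rewrite -compA (compA (bwd g)) bwdK comp1m bwdK. Qed.

Lemma iso_comp_inv (C : Cat) (x y z : C) (g : Iso y z) (f : Iso x y) :
  (g ∘ f) ∘ (bwd f ∘ bwd g) = idm z.
Proof. by rewrite -compA (compA (fwd f)) fwdK comp1m fwdK. Qed.

Definition iso_comp (C : Cat) (x y z : C) (g : Iso y z) (f : Iso x y) : Iso x z :=
  {| fwd := g ∘ f; bwd := bwd f ∘ bwd g;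
     bwdK := iso_compK g f; fwdK := iso_comp_inv g f |}.

Definition iso_op (C : Cat) (x y : C) (f : Iso x y) : @Iso (opCat C) x y :=
  @Build_Iso (opCat C) x y (bwd f) (fwd f) (bwdK f) (fwdK f).

Definition iso_unop (C : Cat) (x y : C) (f : @Iso (opCat C) x y) : Iso x y :=
  @Build_Iso C x y (bwd f) (fwd f) (bwdK f) (fwdK f).

Definition iso_unop' (C : Cat) (x y : C) (f : @Iso (opCat C) x y) : Iso y x :=
  @Build_Iso C y x (fwd f) (bwd f) (fwdK f) (bwdK f).

Section MonoidalFacts.
Context {C : Cat} (V : Monoidal C).

Lemma tensIso_bwdK a b a' b' (f : Iso a a') (g : Iso b b') :
  (bwd f ⊠[V] bwd g) ∘ (f ⊠[V] g) = idm (a ⊗[V] b).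
Proof. by rewrite -tensmD !bwdK tensm1. Qed.

Lemma tensIso_fwdK a b a' b' (f : Iso a a') (g : Iso b b') :
  (f ⊠[V] g) ∘ (bwd f ⊠[V] bwd g) = idm (a' ⊗[V] b').
Proof. by rewrite -tensmD !fwdK tensm1. Qed.

Definition tensIso a b a' b' (f : Iso a a') (g : Iso b b') :
    Iso (a ⊗[V] b) (a' ⊗[V] b') :=
  {| fwd := f ⊠[V] g; bwd := bwd f ⊠[V] bwd g;
     bwdK := tensIso_bwdK f g; fwdK := tensIso_fwdK f g |}.

Definition regAction : Action V C :=
  {| act := tens V; actm := @tensm C V; actm1 := tensm1 V; actmD := @tensmD C V;
     aassoc := assoc V; aunit := lunit V; aassoc_nat := @assoc_nat C V;
     aunit_nat := @lunit_nat C V; apentagon := pentagon V; atriangle := triangle V |}.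

Definition idIso (x : C) : Iso x x :=
  {| fwd := idm x; bwd := idm x; bwdK := comp1m (idm x); fwdK := comp1m (idm x) |}.

Lemma triangle_inv a b :
  assoc V a (unit V) b ∘ (bwd (runit V a) ⊠[V] idm b) = idm a ⊠[V] bwd (lunit V b).
Proof.
apply: (@iso_monic _ _ _ _ (tensIso (idIso a) (lunit V b))).
rewrite [RHS](tensIso_fwdK (idIso a) (lunit V b)) /= compA triangle.
by rewrite -tensmD fwdK comp1m tensm1.
Qed.
End MonoidalFacts.

Section ActionFacts.
Context {C : Cat} {V : Monoidal C} {M : Cat} (a : Action V M).

Lemma actF_D c x y z (g : hom y z) (f : hom x y) :
  actm a (idm c) (g ∘ f) = actm a (idm c) g ∘ actm a (idm c) f.
Proof. by rewrite -actmD comp1m. Qed.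

Definition actF (c : C) : Functor M M :=
  {| fob := act a c; fmap := fun x y f => actm a (idm c) f;
     fmap1 := actm1 a c; fmapD := actF_D c |}.

Lemma actR_D m x y z (g : hom y z) (f : hom x y) :
  actm a (g ∘ f) (idm m) = actm a g (idm m) ∘ actm a f (idm m).
Proof. by rewrite -actmD comp1m. Qed.

Definition actR (m : M) : Functor C M :=
  {| fob := fun c => c ▷[a] m; fmap := fun x y f => actm a f (idm m);
     fmap1 := fun c => actm1 a c m; fmapD := actR_D m |}.

Lemma actm_lr c c' m m' (f : hom c c') (g : hom m m') :
  actm a f (idm m') ∘ actm a (idm c) g = actm a f g.
Proof. by rewrite -actmD comp1m compm1. Qed.

Lemma actm_rl c c' m m' (f : hom c c') (g : hom m m') :
  actm a (idm c') g ∘ actm a f (idm m) = actm a f g.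
Proof. by rewrite -actmD comp1m compm1. Qed.

Lemma actIso_bwdK c c' m m' (f : Iso c c') (g : Iso m m') :
  actm a (bwd f) (bwd g) ∘ actm a f g = idm (c ▷[a] m).
Proof. by rewrite -actmD !bwdK actm1. Qed.

Lemma actIso_fwdK c c' m m' (f : Iso c c') (g : Iso m m') :
  actm a f g ∘ actm a (bwd f) (bwd g) = idm (c' ▷[a] m').
Proof. by rewrite -actmD !fwdK actm1. Qed.

Definition actIso c c' m m' (f : Iso c c') (g : Iso m m') :
    Iso (c ▷[a] m) (c' ▷[a] m') :=
  {| fwd := actm a f g; bwd := actm a (bwd f) (bwd g);
     bwdK := actIso_bwdK f g; fwdK := actIso_fwdK f g |}.

Lemma unit_act_faithful m m' (f g : hom m m') :
  actm a (idm (unit V)) f = actm a (idm (unit V)) g -> f = g.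
Proof. by move=> E; apply: (@iso_epic _ _ _ _ (aunit a m)); rewrite -!aunit_nat E. Qed.

Lemma aunit_assoc c m :
  aunit a (c ▷[a] m) ∘ aassoc a (unit V) c m = actm a (lunit V c) (idm m).
Proof.
apply: unit_act_faithful.
apply: (@iso_epic _ _ _ _ (aassoc a (unit V) (unit V ⊗[V] c) m)).
apply: (@iso_epic _ _ _ _ (actIso (assoc V (unit V) (unit V) c) (idIso m))) => /=.
rewrite -aassoc_nat -!compA -actmD comp1m triangle.
have := apentagon a (unit V) (unit V) c m.
move/(congr1 (fun h => actm a (idm (unit V)) (aunit a (c ▷[a] m)) ∘ h)).
rewrite !compA -!(actF_D (unit V)) atriangle => E.
by rewrite -E -(actm1 a c m) -aassoc_nat.
Qed.
End ActionFacts.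

Section OpMon.
Context {C : Cat} (V : Monoidal C).

Lemma opMon_pentagon a b c d :
  bwd (assoc V (a ⊗[V] b) c d) ∘ bwd (assoc V a b (c ⊗[V] d)) =
  (bwd (assoc V a b c) ⊠[V] idm d) ∘ (bwd (assoc V a (b ⊗[V] c) d)
     ∘ (idm a ⊠[V] bwd (assoc V b c d))).
Proof.
apply: (@iso_monic _ _ _ _ (iso_comp (assoc V a b (c ⊗[V] d)) (assoc V (a ⊗[V] b) c d))).
rewrite [fwd _ ∘ _ in LHS](fwdK (iso_comp _ _)) /= pentagon !compA.
rewrite -(compA _ (_ ⊠[V] idm d) (_ ⊠[V] idm d)) -tensmD fwdK comp1m tensm1 compm1.
by rewrite -(compA _ (fwd _) (bwd _)) fwdK compm1 -tensmD fwdK comp1m tensm1.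
Qed.

Lemma opMon_triangle a b :
  bwd (assoc V a (unit V) b) ∘ (idm a ⊠[V] bwd (lunit V b)) = bwd (runit V a) ⊠[V] idm b.
Proof.
apply: (@iso_monic _ _ _ _ (tensIso V (runit V a) (idIso b))) => /=.
rewrite -tensmD fwdK comp1m tensm1 -triangle compA.
by rewrite -(compA _ (fwd _) (bwd _)) fwdK compm1 -tensmD fwdK comp1m tensm1.
Qed.

Definition opMon : Monoidal (opCat C) :=
  @Build_Monoidal (opCat C) (tens V) (unit V)
    (fun a a' b b' f g => @tensm C V a' a b' b f g)
    (tensm1 V)
    (fun a a' a'' b b' b'' f' g' f g => @tensmD C V _ _ _ _ _ _ f g f' g')
    (fun a b c => iso_op (assoc V a b c))
    (fun a => iso_op (lunit V a)) (fun a => iso_op (runit V a))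
    (fun a b c a' b' c' f g h => esym (iso_sq (@assoc_nat C V _ _ _ _ _ _ f g h)))
    (fun a a' f => esym (iso_sq (@lunit_nat C V _ _ f)))
    (fun a a' f => esym (iso_sq (@runit_nat C V _ _ f)))
    opMon_pentagon opMon_triangle.
End OpMon.

Section RevOp.
Context {C : Cat} (T : Monoidal (opCat C)).

(** A monoidal structure on [C^op] gives one on [C], with reversed tensor product. *)
Definition revOp : Monoidal C :=
  @Build_Monoidal C (fun x y => tens T y x) (unit T)
    (fun a a' b b' f g => @tensm (opCat C) T b' b a' a g f)
    (fun a b => tensm1 T b a)
    (fun a a' a'' b b' b'' f' g' f g => @tensmD (opCat C) T _ _ _ _ _ _ g f g' f')
    (fun a b c => iso_unop' (assoc T c b a))
    (fun a => iso_unop (runit T a)) (fun a => iso_unop (lunit T a))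
    (fun a b c a' b' c' f g h => esym (@assoc_nat (opCat C) T c' b' a' c b a h g f))
    (fun a a' f => esym (iso_sq (@runit_nat (opCat C) T a' a f)))
    (fun a a' f => esym (iso_sq (@lunit_nat (opCat C) T a' a f)))
    (fun a b c d => etrans (@pentagon (opCat C) T d c b a) (esym (compA _ _ _)))
    (fun a b => triangle_inv T b a).
End RevOp.

Record StrongMon (C D : Cat) (V : Monoidal C) (W : Monoidal D) (F : Functor C D) := {
  smul : forall x y, Iso (F (x ⊗[V] y)) (F x ⊗[W] F y);
  sunit : Iso (F (unit V)) (unit W);
  smul_nat : forall x y x' y' (f : hom x x') (g : hom y y'),
    smul x' y' ∘ fmap F (f ⊠[V] g) = (fmap F f ⊠[W] fmap F g) ∘ smul x y;
  smul_assoc : forall x y z,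
    (idm (F x) ⊠[W] smul y z) ∘ smul x (y ⊗[V] z) ∘ fmap F (assoc V x y z) =
    assoc W (F x) (F y) (F z) ∘ (smul x y ⊠[W] idm (F z)) ∘ smul (x ⊗[V] y) z;
  smul_lunit : forall x,
    lunit W (F x) ∘ (sunit ⊠[W] idm (F x)) ∘ smul (unit V) x = fmap F (lunit V x);
  smul_runit : forall x,
    runit W (F x) ∘ (idm (F x) ⊠[W] sunit) ∘ smul x (unit V) = fmap F (runit V x) }.

(** Coherence of a tensor product on [C] for which a faithful functor [F] to a
    monoidal category is compatible with all structure isomorphisms. *)
Section TransportLaws.
Context {C D : Cat} (F : Functor C D) (W : Monoidal D).
Context (F_inj : forall x y (f g : hom x y), fmap F f = fmap F g -> f = g).
Context (t : C -> C -> C).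
Context (tm : forall x x' y y', hom x x' -> hom y y' -> hom (t x y) (t x' y')).
Context (mu : forall x y, Iso (F (t x y)) (F x ⊗[W] F y)).
Context (mu_nat : forall x x' y y' (f : hom x x') (g : hom y y'),
  mu x' y' ∘ fmap F (tm f g) = (fmap F f ⊠[W] fmap F g) ∘ mu x y).
Context (e : C) (eps : Iso (F e) (unit W)).
Context (al : forall x y z, Iso (t (t x y) z) (t x (t y z))).
Context (al_mu : forall x y z,
  (idm (F x) ⊠[W] mu y z) ∘ mu x (t y z) ∘ fmap F (al x y z) =
  assoc W (F x) (F y) (F z) ∘ (mu x y ⊠[W] idm (F z)) ∘ mu (t x y) z).
Context (ll : forall x, Iso (t e x) x) (rr : forall x, Iso (t x e) x).
Context (ll_mu : forall x,
  lunit W (F x) ∘ (eps ⊠[W] idm (F x)) ∘ mu e x = fmap F (ll x)).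
Context (rr_mu : forall x,
  runit W (F x) ∘ (idm (F x) ⊠[W] eps) ∘ mu x e = fmap F (rr x)).

Lemma tl_ext x y z (f g : hom x (t y z)) :
  mu y z ∘ fmap F f = mu y z ∘ fmap F g -> f = g.
Proof. by move/iso_monic/F_inj. Qed.

Lemma tl_ext3 x y z w (f g : hom x (t y (t z w))) :
  (idm (F y) ⊠[W] mu z w) ∘ mu y (t z w) ∘ fmap F f =
  (idm (F y) ⊠[W] mu z w) ∘ mu y (t z w) ∘ fmap F g -> f = g.
Proof.
rewrite -!compA => H; apply: tl_ext; move: H.
exact: (@iso_monic _ _ _ _ (tensIso W (idIso (F y)) (mu z w))).
Qed.

Lemma mu_natl x x' y y' z z' (f : hom x x') (g : hom y y') (h : hom (F z) (F z')) :
  (mu x' y' ⊠[W] idm (F z')) ∘ (fmap F (tm f g) ⊠[W] h) =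
  ((fmap F f ⊠[W] fmap F g) ⊠[W] h) ∘ (mu x y ⊠[W] idm (F z)).
Proof. by rewrite -!tensmD mu_nat comp1m compm1. Qed.

Lemma mu_natr x x' y y' z z' (f : hom x x') (g : hom y y') (h : hom (F z) (F z')) :
  (idm (F z') ⊠[W] mu x' y') ∘ (h ⊠[W] fmap F (tm f g)) =
  (h ⊠[W] (fmap F f ⊠[W] fmap F g)) ∘ (idm (F z) ⊠[W] mu x y).
Proof. by rewrite -!tensmD mu_nat comp1m compm1. Qed.

Lemma tl_assoc_nat a b c a' b' c' (f : hom a a') (g : hom b b') (h : hom c c') :
  al a' b' c' ∘ tm (tm f g) h =
  tm f (tm g h) ∘ al a b c.
Proof.
apply: tl_ext3; rewrite !(fmapD F) !compA al_mu.
rewrite (pre2 _ (mu_nat (tm f g) h)) compA.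
rewrite (pre2 _ (mu_natl f g _)) compA assoc_nat.
rewrite (pre2 _ (mu_nat f (tm g h))) compA mu_natr.
by rewrite (pre3 _ (al_mu a b c)) !compA.
Qed.

Lemma tl_lunit_nat a a' (f : hom a a') :
  ll a' ∘ tm (idm e) f = f ∘ ll a.
Proof.
apply: F_inj; rewrite (fmapD F (ll _)) (fmapD F f) -!ll_mu -!compA mu_nat fmap1 !compA.
rewrite -(compA _ (eps ⊠[W] _)) -tensmD compm1 comp1m.
by rewrite -[fwd eps]comp1m -{1}[fmap F f]compm1 tensmD !compA lunit_nat comp1m.
Qed.

Lemma tl_runit_nat a a' (f : hom a a') :
  rr a' ∘ tm f (idm e) = f ∘ rr a.
Proof.
apply: F_inj; rewrite (fmapD F (rr _)) (fmapD F f) -!rr_mu -!compA mu_nat fmap1 !compA.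
rewrite -(compA _ (_ ⊠[W] eps)) -tensmD compm1 comp1m.
by rewrite -[fwd eps]comp1m -{1}[fmap F f]compm1 tensmD !compA runit_nat comp1m.
Qed.

Lemma tl_pentagon a b c d :
  al a b (t c d) ∘ al (t a b) c d =
  tm (idm a) (al b c d) ∘ al a (t b c) d
    ∘ tm (al a b c) (idm d).
Proof.
apply: tl_ext3; rewrite !(fmapD F).
apply: (@iso_monic _ _ _ _ (tensIso W (idIso (F a)) (tensIso W (idIso (F b)) (mu c d)))).
rewrite /= !compA.
have H1 : (idm (F a) ⊠[W] (idm (F b) ⊠[W] mu c d))
    ∘ (idm (F a) ⊠[W] mu b (t c d)) ∘ mu a (t b (t c d))
    ∘ fmap F (al a b (t c d)) =
    assoc W _ _ _ ∘ (mu a b ⊠[W] mu c d) ∘ mu (t a b) (t c d).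
  rewrite (pre3 _ (al_mu _ _ _)) !compA -assoc_nat tensm1.
  by rewrite (pre2 _ (esym (tensmD _ _ _ _ _))) comp1m compm1.
rewrite {}H1.
have -> : mu a b ⊠[W] mu c d = (mu a b ⊠[W] idm _) ∘ (idm _ ⊠[W] mu c d).
  by rewrite -tensmD comp1m compm1.
rewrite compA (pre3 _ (al_mu (t a b) c d)) !compA -(tensm1 W (F c)).
rewrite (pre2 _ (esym (assoc_nat W _ _ _))) !compA pentagon.
rewrite (pre2 _ (mu_nat _ _)) compA fmap1.
have H2 : (idm (F a) ⊠[W] (idm (F b) ⊠[W] mu c d))
    ∘ (idm (F a) ⊠[W] mu b (t c d)) ∘ (idm (F a) ⊠[W] fmap F (al b c d)) =
    (idm (F a) ⊠[W] assoc W _ _ _) ∘ (idm (F a) ⊠[W] (mu b c ⊠[W] idm (F d)))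
    ∘ (idm (F a) ⊠[W] mu (t b c) d).
  by rewrite -!tensmD !comp1m al_mu.
rewrite {}H2 (pre3 _ (al_mu a (t b c) d)) !compA.
rewrite (pre2 _ (esym (assoc_nat W _ _ _))) !compA.
rewrite (pre2 _ (mu_nat _ _)) compA fmap1.
have H3 : ((idm (F a) ⊠[W] mu b c) ⊠[W] idm (F d))
    ∘ (mu a (t b c) ⊠[W] idm (F d)) ∘ (fmap F (al a b c) ⊠[W] idm (F d)) =
    (assoc W _ _ _ ⊠[W] idm (F d)) ∘ ((mu a b ⊠[W] idm (F c)) ⊠[W] idm (F d))
    ∘ (mu (t a b) c ⊠[W] idm (F d)).
  by rewrite -!tensmD !comp1m al_mu.
by rewrite (pre3 _ H3) !compA.
Qed.

Lemma tl_triangle a b :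
  tm (idm a) (ll b) ∘ al a e b = tm (rr a) (idm b).
Proof.
apply: tl_ext; rewrite (fmapD F (tm _ _)) compA !mu_nat !fmap1 -ll_mu -rr_mu.
have -> : idm (F a) ⊠[W] (lunit W (F b) ∘ (eps ⊠[W] idm (F b)) ∘ mu e b)
   = (idm (F a) ⊠[W] lunit W (F b)) ∘ (idm (F a) ⊠[W] (eps ⊠[W] idm (F b)))
     ∘ (idm (F a) ⊠[W] mu e b) by rewrite -!tensmD !comp1m.
rewrite (pre3 _ (al_mu _ _ _)) !compA (pre2 _ (esym (assoc_nat _ _ _ _))).
by rewrite !compA triangle -!tensmD !comp1m.
Qed.
End TransportLaws.

Section Transport.
Context {C D : Cat} (F : Functor C D) (E : Equivalence F) (W : Monoidal D).
Context (e : C) (eps : Iso (F e) (unit W)).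

Lemma equiv_faithful x y (f g : hom x y) : fmap F f = fmap F g -> f = g.
Proof.
move=> H; apply: (@iso_monic _ _ _ _ (eunit E y)).
by have := nnat (eunit E) g; rewrite (nnat (eunit E) f) /= H => <-.
Qed.

Lemma qinv_faithful x y (f g : hom x y) : fmap (qinv E) f = fmap (qinv E) g -> f = g.
Proof.
move=> H; apply: (@iso_epic _ _ _ _ (ecounit E x)).
by have := nnat (ecounit E) g; rewrite /= -H => <-; rewrite -(nnat (ecounit E) f).
Qed.

Definition preim x y (f : hom (F x) (F y)) : hom x y :=
  bwd (eunit E y) ∘ fmap (qinv E) f ∘ eunit E x.

Lemma preimK x y (f : hom (F x) (F y)) : fmap F (preim f) = f.
Proof.
apply: qinv_faithful.
apply: (@iso_epic _ _ _ _ (eunit E x)).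
have /= <- := nnat (eunit E) (preim f).
by rewrite /preim !compA fwdK comp1m.
Qed.

Lemma preim_bwdK x y (f : Iso (F x) (F y)) : preim (bwd f) ∘ preim f = idm x.
Proof. by apply: equiv_faithful; rewrite fmapD !preimK bwdK fmap1. Qed.

Lemma preim_fwdK x y (f : Iso (F x) (F y)) : preim f ∘ preim (bwd f) = idm y.
Proof. by apply: equiv_faithful; rewrite fmapD !preimK fwdK fmap1. Qed.

Definition preimIso x y (f : Iso (F x) (F y)) : Iso x y :=
  {| fwd := preim f; bwd := preim (bwd f); bwdK := preim_bwdK f; fwdK := preim_fwdK f |}.

Definition tr_tens (x y : C) : C := qinv E (F x ⊗[W] F y).

Definition tr_tensm x x' y y' (f : hom x x') (g : hom y y') :
    hom (tr_tens x y) (tr_tens x' y') := fmap (qinv E) (fmap F f ⊠[W] fmap F g).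

Definition tr_mul (x y : C) : Iso (F (tr_tens x y)) (F x ⊗[W] F y) := ecounit E _.

Lemma tr_mul_nat x x' y y' (f : hom x x') (g : hom y y') :
  tr_mul x' y' ∘ fmap F (tr_tensm f g) = (fmap F f ⊠[W] fmap F g) ∘ tr_mul x y.
Proof. exact: (nnat (ecounit E)). Qed.

Definition tr_assoc x y z : Iso (tr_tens (tr_tens x y) z) (tr_tens x (tr_tens y z)) :=
  preimIso
    (iso_comp
      (iso_inv (iso_comp (tensIso W (idIso (F x)) (tr_mul y z)) (tr_mul x (tr_tens y z))))
      (iso_comp (assoc W (F x) (F y) (F z))
        (iso_comp (tensIso W (tr_mul x y) (idIso (F z))) (tr_mul (tr_tens x y) z)))).

Definition tr_lunit x : Iso (tr_tens e x) x :=
  preimIso (iso_comp (lunit W (F x))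
    (iso_comp (tensIso W eps (idIso (F x))) (tr_mul e x))).

Definition tr_runit x : Iso (tr_tens x e) x :=
  preimIso (iso_comp (runit W (F x))
    (iso_comp (tensIso W (idIso (F x)) eps) (tr_mul x e))).

Lemma tr_mul_assoc x y z :
  (idm (F x) ⊠[W] tr_mul y z) ∘ tr_mul x (tr_tens y z) ∘ fmap F (tr_assoc x y z) =
  assoc W (F x) (F y) (F z) ∘ (tr_mul x y ⊠[W] idm (F z)) ∘ tr_mul (tr_tens x y) z.
Proof.
rewrite [fmap F _](preimK _) /= [in LHS]compA.
set i := iso_comp (tensIso W (idIso (F x)) (tr_mul y z)) (tr_mul x (tr_tens y z)).
by rewrite (fwdK i) comp1m !compA.
Qed.

Lemma tr_mul_lunit x :
  lunit W (F x) ∘ (eps ⊠[W] idm (F x)) ∘ tr_mul e x = fmap F (tr_lunit x).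
Proof. by rewrite [fmap F _](preimK _) /= compA. Qed.

Lemma tr_mul_runit x :
  runit W (F x) ∘ (idm (F x) ⊠[W] eps) ∘ tr_mul x e = fmap F (tr_runit x).
Proof. by rewrite [fmap F _](preimK _) /= compA. Qed.

Lemma tr_tensm1 x y : tr_tensm (idm x) (idm y) = idm (tr_tens x y).
Proof. by rewrite /tr_tensm !fmap1 tensm1 fmap1. Qed.

Lemma tr_tensmD a a' a'' b b' b'' (f' : hom a' a'') (g' : hom b' b'')
    (f : hom a a') (g : hom b b') :
  tr_tensm (f' ∘ f) (g' ∘ g) = tr_tensm f' g' ∘ tr_tensm f g.
Proof. by rewrite /tr_tensm !fmapD tensmD fmapD. Qed.

Definition transMon : Monoidal C :=
  @Build_Monoidal C tr_tens e tr_tensm tr_tensm1 tr_tensmD tr_assoc tr_lunit tr_runit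
    (tl_assoc_nat equiv_faithful tr_mul_nat tr_mul_assoc)
    (tl_lunit_nat equiv_faithful tr_mul_nat tr_mul_lunit)
    (tl_runit_nat equiv_faithful tr_mul_nat tr_mul_runit)
    (tl_pentagon equiv_faithful tr_mul_nat tr_mul_assoc)
    (tl_triangle equiv_faithful tr_mul_nat tr_mul_assoc tr_mul_lunit tr_mul_runit).

Definition transStrong : StrongMon transMon W F :=
  @Build_StrongMon C D transMon W F tr_mul eps
    (fun x y x' y' f g => tr_mul_nat f g) tr_mul_assoc tr_mul_lunit tr_mul_runit.
End Transport.

Section Pull.
Context {C D : Cat} {V : Monoidal C} {W : Monoidal D} {F : Functor C D}.
Context (S : StrongMon V W F) {M : Cat} (a : Action W M).

Definition pull_map c c' m m' (f : hom c c') (g : hom m m') :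
    hom (F c ▷[a] m) (F c' ▷[a] m') := actm a (fmap F f) g.

Definition pull_assoc c d m : Iso (F (c ⊗[V] d) ▷[a] m) (F c ▷[a] F d ▷[a] m) :=
  iso_comp (aassoc a (F c) (F d) m) (actIso a (smul S c d) (idIso m)).

Definition pull_unit m : Iso (F (unit V) ▷[a] m) m :=
  iso_comp (aunit a m) (actIso a (sunit S) (idIso m)).

Lemma pull_map1 c m : pull_map (idm c) (idm m) = idm (F c ▷[a] m).
Proof. by rewrite /pull_map fmap1 actm1. Qed.

Lemma pull_mapD c c' c'' m m' m'' (f' : hom c' c'') (g' : hom m' m'')
    (f : hom c c') (g : hom m m') :
  pull_map (f' ∘ f) (g' ∘ g) = pull_map f' g' ∘ pull_map f g.
Proof. by rewrite /pull_map fmapD actmD. Qed.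

Lemma pull_assoc_nat c d m c' d' m' (f : hom c c') (g : hom d d') (h : hom m m') :
  pull_assoc c' d' m' ∘ pull_map (f ⊠[V] g) h =
  pull_map f (pull_map g h) ∘ pull_assoc c d m.
Proof.
rewrite /= /pull_map -compA -actmD smul_nat comp1m -(compm1 h) actmD !compA aassoc_nat.
by rewrite compm1.
Qed.

Lemma pull_unit_nat m m' (h : hom m m') :
  pull_unit m' ∘ pull_map (idm (unit V)) h = h ∘ pull_unit m.
Proof.
rewrite /= /pull_map -compA -actmD fmap1 compm1 comp1m.
by rewrite -(actm_rl a (sunit S) h) !compA aunit_nat.
Qed.

Lemma pull_pentagon b c d m :
  pull_assoc b c (F d ▷[a] m) ∘ pull_assoc (b ⊗[V] c) d m =
  pull_map (idm b) (pull_assoc c d m) ∘ pull_assoc b (c ⊗[V] d) m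
    ∘ pull_map (assoc V b c d) (idm m).
Proof.
rewrite /= /pull_map fmap1 compA.
have E1 : actm a (smul S b c) (idm (F d ▷[a] m)) ∘ aassoc a (F (b ⊗[V] c)) (F d) m
  = aassoc a _ _ m ∘ actm a (smul S b c ⊠[W] idm (F d)) (idm m).
  by rewrite aassoc_nat actm1.
rewrite (pre2 _ E1) !compA apentagon.
have E2 : actm a (idm (F b)) (aassoc a (F c) (F d) m ∘ actm a (smul S c d) (idm m))
  = actm a (idm (F b)) (aassoc a (F c) (F d) m)
    ∘ actm a (idm (F b)) (actm a (smul S c d) (idm m)).
  by rewrite -actmD comp1m.
rewrite E2 (pre2 _ (esym (aassoc_nat a _ _ _))) !compA.
rewrite -!compA; congr (_ ∘ (_ ∘ _)); rewrite -!actmD !comp1m.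
by rewrite [in RHS]compA (smul_assoc S b c d) compA.
Qed.

Lemma pull_triangle c m :
  pull_map (idm c) (pull_unit m) ∘ pull_assoc c (unit V) m =
  pull_map (runit V c) (idm m).
Proof.
rewrite /= /pull_map.
have -> : actm a (fmap F (idm c)) (aunit a m ∘ actm a (sunit S) (idm m))
  = actm a (idm (F c)) (aunit a m) ∘ actm a (idm (F c)) (actm a (sunit S) (idm m)).
  by rewrite -actmD comp1m fmap1.
rewrite compA (pre2 _ (esym (aassoc_nat a _ _ _))) compA atriangle -!actmD !comp1m.
by rewrite smul_runit.
Qed.

Definition pullAction : Action V M :=
  @Build_Action C V M (fun c m => F c ▷[a] m) pull_map pull_map1 pull_mapD
    pull_assoc pull_unit pull_assoc_nat pull_unit_nat pull_pentagon pull_triangle.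

(** The functor [pullAction c ▷ -] is [F c ▷ -] up to the equation
    [fmap F (idm c) = idm (F c)]. *)
Section PullAdjoint.
Context (c : C) (R : RightAdjoint (actF a (F c))).

Lemma pull_counit_lift x d (f : hom (F c ▷[a] x) d) :
  counit R d ∘ pull_map (idm c) (lift R f) = f.
Proof. by rewrite /pull_map fmap1; exact: (@counit_lift M M (actF a (F c)) R). Qed.

Lemma pull_lift_counit x d (g : hom x (R d)) :
  lift R (counit R d ∘ pull_map (idm c) g) = g.
Proof. by rewrite /pull_map fmap1; exact: (@lift_counit M M (actF a (F c)) R). Qed.

Definition pull_radj : RightAdjoint (actF pullAction c) :=
  @Build_RightAdjoint M M (actF pullAction c) (radj R) (counit R) (@lift _ _ _ R)
    pull_counit_lift pull_lift_counit.
End PullAdjoint.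
End Pull.

(** If [T] is a monoidal structure on [C^op] acting on [M] such that each [c ▷ -]
    has a right adjoint [c ▶ -], then [▶] is an action of [revOp T] on [M]. *)
Section AdjAction.
Context {C : Cat} {T : Monoidal (opCat C)} {M : Cat} (b : Action T M).
Context (R : forall c : opCat C, RightAdjoint (actF b c)).

Definition opm (c c' : C) (f : hom c c') : @hom (opCat C) c' c := f.

Definition aa_br (c : opCat C) x m (u : hom x (R c m)) : hom (c ▷[b] x) m :=
  counit (R c) m ∘ actm b (idm c) u.

Lemma aa_br_inj c x m (u v : hom x (R c m)) : aa_br u = aa_br v -> u = v.
Proof. exact: (@lift_inj M M (actF b c) (R c)). Qed.

Lemma aa_br_lift (c : opCat C) x m (f : hom (c ▷[b] x) m) : aa_br (lift (R c) f) = f.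
Proof. exact: (@counit_lift M M (actF b c) (R c)). Qed.

Lemma aa_br_nat (c : opCat C) x y m (u : hom y (R c m)) (v : hom x y) :
  aa_br (u ∘ v) = aa_br u ∘ actm b (idm c) v.
Proof. by rewrite /aa_br actF_D compA. Qed.

Definition aa_map (c c' : C) (m m' : M) (f : hom c c') (g : hom m m') :
    hom (R c m) (R c' m') :=
  lift (R c') (g ∘ counit (R c) m ∘ actm b (opm f) (idm (R c m))).

Lemma aa_br_map (c c' : C) m m' (f : hom c c') (g : hom m m') x (u : hom x (R c m)) :
  aa_br (aa_map f g ∘ u) = g ∘ aa_br u ∘ actm b (opm f) (idm x).
Proof. by rewrite aa_br_nat aa_br_lift -!compA actm_lr actm_rl. Qed.

Definition aa_assoc_fwd (c d : opCat C) m : hom (R (d ⊗[T] c) m) (R c (R d m)) :=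
  lift (R c) (lift (R d) (counit (R (d ⊗[T] c)) m ∘ bwd (aassoc b d c _))).

Definition aa_assoc_bwd (c d : opCat C) m : hom (R c (R d m)) (R (d ⊗[T] c) m) :=
  lift (R (d ⊗[T] c))
    (counit (R d) m ∘ actm b (idm d) (counit (R c) (R d m)) ∘ aassoc b d c _).

Lemma aassoc_inv_natr (c d : opCat C) x y (u : hom x y) :
  bwd (aassoc b d c y) ∘ actm b (idm d) (actm b (idm c) u) =
  actm b (idm (d ⊗[T] c)) u ∘ bwd (aassoc b d c x).
Proof. by apply: iso_sq; rewrite -(aassoc_nat b) tensm1. Qed.

Lemma aa_br_assoc (c d : opCat C) m x (u : hom x (R (d ⊗[T] c) m)) :
  aa_br (aa_br (aa_assoc_fwd c d m ∘ u)) = aa_br u ∘ bwd (aassoc b d c x).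
Proof.
rewrite (aa_br_nat (aa_assoc_fwd c d m) u) aa_br_lift.
by rewrite (aa_br_nat (lift _ _)) aa_br_lift -compA aassoc_inv_natr compA.
Qed.

Lemma aa_br_assoc_bwd (c d : opCat C) m x (u : hom x (R c (R d m))) :
  aa_br (aa_assoc_bwd c d m ∘ u) = aa_br (aa_br u) ∘ aassoc b d c x.
Proof.
rewrite aa_br_nat aa_br_lift /aa_br actF_D -!compA; congr (_ ∘ (_ ∘ _)).
by rewrite -(aassoc_nat b) tensm1.
Qed.

Lemma aa_assoc_bwdK c d m : aa_assoc_bwd c d m ∘ aa_assoc_fwd c d m = idm _.
Proof.
apply: aa_br_inj; rewrite aa_br_assoc_bwd -(compm1 (aa_assoc_fwd c d m)) aa_br_assoc.
by rewrite -compA bwdK compm1.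
Qed.

Lemma aa_assoc_fwdK c d m : aa_assoc_fwd c d m ∘ aa_assoc_bwd c d m = idm _.
Proof.
apply: aa_br_inj; apply: aa_br_inj; rewrite aa_br_assoc -(compm1 (aa_assoc_bwd c d m)).
by rewrite aa_br_assoc_bwd -compA fwdK compm1.
Qed.

Definition aa_assoc (c d : opCat C) m : Iso (R (d ⊗[T] c) m) (R c (R d m)) :=
  {| fwd := aa_assoc_fwd c d m; bwd := aa_assoc_bwd c d m;
     bwdK := aa_assoc_bwdK c d m; fwdK := aa_assoc_fwdK c d m |}.

Definition aa_unit_fwd m : hom (R (unit T) m) m :=
  counit (R (unit T)) m ∘ bwd (aunit b _).

Definition aa_unit_bwd m : hom m (R (unit T) m) := lift (R (unit T)) (aunit b m).

Lemma aa_unit_br m x (u : hom x (R (unit T) m)) :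
  aa_unit_fwd m ∘ u = aa_br u ∘ bwd (aunit b x).
Proof.
rewrite /aa_unit_fwd /aa_br -!compA; congr (_ ∘ _).
by apply: iso_sq; rewrite aunit_nat.
Qed.

Lemma aa_unit_bwdK m : aa_unit_bwd m ∘ aa_unit_fwd m = idm _.
Proof.
apply: aa_br_inj; rewrite aa_br_nat aa_br_lift aunit_nat.
by rewrite /aa_unit_fwd /aa_br actm1 -compA bwdK.
Qed.

Lemma aa_unit_fwdK m : aa_unit_fwd m ∘ aa_unit_bwd m = idm _.
Proof. by rewrite aa_unit_br aa_br_lift fwdK. Qed.

Definition aa_unit m : Iso (R (unit T) m) m :=
  {| fwd := aa_unit_fwd m; bwd := aa_unit_bwd m;
     bwdK := aa_unit_bwdK m; fwdK := aa_unit_fwdK m |}.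

Lemma aa_br_map1 (c c' : C) m m' (f : hom c c') (g : hom m m') :
  aa_br (aa_map f g) = g ∘ counit (R c) m ∘ actm b (opm f) (idm (R c m)).
Proof. exact: aa_br_lift. Qed.

Lemma aa_br_assoc1 (c d : opCat C) m :
  aa_br (aa_br (aa_assoc_fwd c d m)) = counit (R (d ⊗[T] c)) m ∘ bwd (aassoc b d c _).
Proof. by rewrite !aa_br_lift. Qed.

Lemma aa_map_1 (c : C) m : aa_map (idm c) (idm m) = idm (R c m).
Proof.
by apply: aa_br_inj; rewrite aa_br_map1 comp1m /aa_br.
Qed.

Lemma aa_map_D (c c' c'' : C) m m' m'' (f' : hom c' c'') (g' : hom m' m'')
    (f : hom c c') (g : hom m m') :
  aa_map (f' ∘ f) (g' ∘ g) = aa_map f' g' ∘ aa_map f g.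
Proof.
apply: aa_br_inj; rewrite aa_br_map aa_br_map1 aa_br_map1 -!compA.
by rewrite actR_D.
Qed.

Lemma aassoc_inv_nat (c d c' d' : opCat C) m m' (f : hom c c') (g : hom d d')
    (h : hom m m') :
  bwd (aassoc b d' c' m') ∘ actm b g (actm b f h) =
  actm b (g ⊠[T] f) h ∘ bwd (aassoc b d c m).
Proof. by apply: iso_sq; rewrite (aassoc_nat b). Qed.

Lemma aa_assoc_nat (c d : C) m (c' d' : C) m' (f : hom c c') (g : hom d d') (h : hom m m') :
  aa_assoc_fwd c' d' m' ∘ aa_map (tensm (revOp T) f g) h =
  aa_map f (aa_map g h) ∘ aa_assoc_fwd c d m.
Proof.
apply: aa_br_inj; apply: aa_br_inj; rewrite (aa_br_assoc (aa_map _ h)) aa_br_map1.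
rewrite (aa_br_map f) -(compA (aa_map g h)) (aa_br_map g) aa_br_nat aa_br_assoc1.
rewrite -!compA; congr (_ ∘ (_ ∘ _)); rewrite actm_rl.
by rewrite (aassoc_inv_nat (opm f) (opm g)).
Qed.

Lemma aa_unit_nat m m' (h : hom m m') :
  aa_unit_fwd m' ∘ aa_map (idm (unit T : C)) h = h ∘ aa_unit_fwd m.
Proof. by rewrite aa_unit_br aa_br_map1 actm1 compm1 -compA. Qed.

Lemma apentagon_inv (x y z : opCat C) m :
  bwd (aassoc b x (y ⊗[T] z) m) ∘ actm b (idm x) (bwd (aassoc b y z m)) =
  actm b (assoc T x y z) (idm m) ∘ bwd (aassoc b (x ⊗[T] y) z m)
    ∘ bwd (aassoc b x y (z ▷[b] m)).
Proof.
apply: (@iso_monic _ _ _ _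
  (iso_comp (actIso b (idIso x) (aassoc b y z m)) (aassoc b x (y ⊗[T] z) m))).
rewrite [LHS](fwdK (iso_comp (actIso b (idIso x) (aassoc b y z m)) _)) /= !compA.
rewrite -(apentagon b x y z m) -!compA.
by rewrite (compA (aassoc b (x ⊗[T] y) z m)) fwdK comp1m fwdK.
Qed.

Lemma aa_pentagon (x y z : C) m :
  aa_assoc_fwd x y (R z m) ∘ aa_assoc_fwd (y ⊗[T] x : opCat C) z m =
  aa_map (idm x) (aa_assoc_fwd y z m) ∘ aa_assoc_fwd x (z ⊗[T] y : opCat C) m
    ∘ aa_map (assoc (revOp T) x y z) (idm m).
Proof.
apply: aa_br_inj; apply: aa_br_inj; apply: aa_br_inj.
rewrite aa_br_assoc (aa_br_nat (aa_br (aa_assoc_fwd _ z m))) aa_br_assoc1.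
rewrite -(compA (aa_map _ _)) aa_br_map actm1 compm1 aa_br_assoc aa_br_assoc aa_br_map1.
rewrite comp1m -!compA; congr (_ ∘ _).
by rewrite (apentagon_inv z y x) -!compA.
Qed.

Lemma aa_triangle (c : C) m :
  aa_map (idm c) (aa_unit_fwd m) ∘ aa_assoc_fwd c (unit T) m =
  aa_map (runit (revOp T) c) (idm m).
Proof.
apply: aa_br_inj; rewrite aa_br_map actm1 compm1 aa_unit_br aa_br_assoc1 aa_br_map1.
rewrite comp1m -!compA; congr (_ ∘ _).
apply: (@iso_epic _ _ _ _ (iso_comp (aunit b _) (aassoc b (unit T) c _))).
rewrite [LHS](iso_compK (aunit b _) (aassoc b (unit T) c _)) /= aunit_assoc.
by rewrite -actmD comp1m; have -> := bwdK (lunit T c); rewrite actm1.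
Qed.

Definition adjAction : Action (revOp T) M :=
  @Build_Action C (revOp T) M (fun c m => R c m) aa_map aa_map_1 aa_map_D
    (fun c d m => aa_assoc c d m) aa_unit aa_assoc_nat aa_unit_nat aa_pentagon aa_triangle.
End AdjAction.

Section GVDefs.
Context {C : Cat} (V : Monoidal C).

(** [K] together with, for each [y], an object [G y] representing
    [Hom (- ⊗ y, K)], with universal element [dev y]. *)
Record Dualizing := {
  dK : C;
  dG : C -> C;
  dev : forall y, hom (dG y ⊗[V] y) dK;
  dlift : forall x y, hom (x ⊗[V] y) dK -> hom x (dG y);
  dev_lift : forall x y (f : hom (x ⊗[V] y) dK), dev y ∘ (dlift f ⊠[V] idm y) = f;
  dlift_dev : forall x y (g : hom x (dG y)), dlift (dev y ∘ (g ⊠[V] idm y)) = g }.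

Arguments dlift d {x y} f : rename.
Context (d : Dualizing).

Lemma dlift_inj x y (g g' : hom x (dG d y)) :
  dev d y ∘ (g ⊠[V] idm y) = dev d y ∘ (g' ⊠[V] idm y) -> g = g'.
Proof. by move=> E; rewrite -(@dlift_dev d _ _ g) -(@dlift_dev d _ _ g') E. Qed.

Definition dG_map y y' (f : hom y y') : hom (dG d y') (dG d y) :=
  dlift d (dev d y' ∘ (idm (dG d y') ⊠[V] f)).

Lemma dev_map y y' (f : hom y y') :
  dev d y ∘ (dG_map f ⊠[V] idm y) = dev d y' ∘ (idm (dG d y') ⊠[V] f).
Proof. exact: dev_lift. Qed.

Lemma dG_map1 y : dG_map (idm y) = idm (dG d y).
Proof. by apply: dlift_inj; rewrite dev_map. Qed.

Lemma dG_mapD x y z (g : hom y z) (f : hom x y) : dG_map (g ∘ f) = dG_map f ∘ dG_map g.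
Proof.
apply: dlift_inj; rewrite dev_map.
have -> : (dG_map f ∘ dG_map g) ⊠[V] idm x
  = (dG_map f ⊠[V] idm x) ∘ (dG_map g ⊠[V] idm x) by rewrite -tensmD comp1m.
rewrite compA dev_map -compA -tensmD comp1m compm1.
rewrite -[dG_map g in RHS]compm1 -[f in RHS]comp1m tensmD compA dev_map.
by rewrite -compA -tensmD !comp1m.
Qed.

Definition dGF : Functor (opCat C) C :=
  @Build_Functor (opCat C) C (dG d) (fun y y' f => dG_map (opm f))
    dG_map1 (fun x y z g f => dG_mapD f g).
End GVDefs.
Arguments dlift {C V} d {x y} f : rename.

Section DualUnit.
Context {C : Cat} (V : Monoidal C) (d : Dualizing V) (E : Equivalence (dGF d)).

Local Notation w := (qinv E (unit V) : ob C).
Local Notation i := (ecounit E (unit V) : @Iso C (dG d w) (unit V)).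

Definition du_fwd : hom (unit V) (dG d (dK d)) := dlift d (lunit V (dK d)).

Definition du_j : hom w (dK d) := dev d w ∘ (bwd i ⊠[V] idm w) ∘ bwd (lunit V w).

Definition du_s : hom (dK d) w :=
  @preim (opCat C) C (dGF d) E w (dK d) (du_fwd ∘ i).

Lemma du_s_map : dG_map d du_s = du_fwd ∘ i.
Proof. exact: (@preimK (opCat C) C (dGF d) E w (dK d) (du_fwd ∘ i)). Qed.

Lemma du_j_fwd : dG_map d du_j ∘ du_fwd = bwd i.
Proof.
apply: dlift_inj.
have -> : (dG_map d du_j ∘ du_fwd) ⊠[V] idm w
  = (dG_map d du_j ⊠[V] idm w) ∘ (du_fwd ⊠[V] idm w) by rewrite -tensmD comp1m.
rewrite compA dev_map -compA -tensmD comp1m compm1.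
rewrite -[du_fwd in LHS]compm1 -[du_j in LHS]comp1m tensmD compA dev_lift lunit_nat.
by rewrite /du_j -compA bwdK compm1.
Qed.

Lemma du_js : du_j ∘ du_s = idm (dK d).
Proof.
apply: (@iso_epic _ _ _ _ (lunit V (dK d))).
rewrite comp1m /du_j -compA -lunit_nat -compA (compA (bwd (lunit V w))) bwdK comp1m.
rewrite -compA -tensmD compm1 comp1m.
rewrite -[bwd i in LHS]comp1m -[du_s in LHS]compm1 tensmD compA -dev_map du_s_map.
by rewrite -compA -tensmD -compA fwdK compm1 comp1m dev_lift.
Qed.

Lemma du_bwdK : du_fwd ∘ (i ∘ dG_map d du_j) = idm (dG d (dK d)).
Proof. by rewrite compA -du_s_map -dG_mapD du_js dG_map1. Qed.

Lemma du_fwdK : (i ∘ dG_map d du_j) ∘ du_fwd = idm (unit V).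
Proof. by rewrite -compA du_j_fwd fwdK. Qed.

Definition dualUnit : Iso (dG d (dK d)) (unit V) :=
  {| fwd := i ∘ dG_map d du_j; bwd := du_fwd; bwdK := du_bwdK; fwdK := du_fwdK |}.
End DualUnit.

(** [gv_inv] is the chosen quasi-inverse of [G], exhibiting [G] as an anti-equivalence. *)
Record GVCat := {
  gv_cat :> Cat;
  gv_mon : Monoidal gv_cat;
  gv_dual : Dualizing gv_mon;
  gv_inv : Equivalence (dGF gv_dual) }.

Section Odot.
Context (C : GVCat).

Definition gvG (c : C) : C := dG (gv_dual C) c.

(** On [C^op]: [x, y |-> G^-1 (G x ⊗ G y)], with unit [K] and the unique
    coherence isomorphisms making [G] strong monoidal. *)
Definition odotOp : Monoidal (opCat C) :=
  transMon (gv_inv C) (e := dK (gv_dual C)) (dualUnit (gv_inv C)).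

(** The second tensor product [x ⊙ y = G^-1 (G y ⊗ G x)], with unit [K]. *)
Definition odot : Monoidal C := revOp odotOp.

Lemma odotE (x y : C) : x ⊗[odot] y = qinv (gv_inv C) (gvG y ⊗[gv_mon C] gvG x).
Proof. by []. Qed.

Lemma odot_unitE : unit odot = dK (gv_dual C).
Proof. by []. Qed.

Definition gvG_strong : StrongMon odotOp (gv_mon C) (dGF (gv_dual C)) :=
  transStrong (gv_inv C) (e := dK (gv_dual C)) (dualUnit (gv_inv C)).
End Odot.

Definition is_GV_module (C : Cat) (V : Monoidal C) (M : Cat) (a : Action V M) : Prop :=
  (forall c : C, has_right_adjoint (actF a c)) /\
  (forall m : M, has_right_adjoint (actR a m)).

(** The action [▶] of [(C, ⊙)]: [c ▶ -] is the chosen right adjoint [R c] of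
    [G c ▷ -]. *)
Definition blackAction (C : GVCat) (M : Cat) (a : Action (gv_mon C) M)
    (R : forall c : C, RightAdjoint (actF a (gvG c))) : Action (odot C) M :=
  adjAction (fun c : opCat C => pull_radj (gvG_strong C) (R c)).

Lemma blackActionE (C : GVCat) (M : Cat) (a : Action (gv_mon C) M)
    (R : forall c : C, RightAdjoint (actF a (gvG c))) (c : C) (m : M) :
  c ▷[blackAction R] m = R c m.
Proof. by []. Qed.

Section OpAction.
Context {C : Cat} {V : Monoidal C} {M : Cat} (a : Action V M).

Lemma op_apentagon b c d m :
  bwd (aassoc a (b ⊗[V] c) d m) ∘ bwd (aassoc a b c (d ▷[a] m)) =
  actm a (bwd (assoc V b c d)) (idm m) ∘ (bwd (aassoc a b (c ⊗[V] d) m)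
     ∘ actm a (idm b) (bwd (aassoc a c d m))).
Proof.
apply: (@iso_monic _ _ _ _
  (iso_comp (aassoc a b c (d ▷[a] m)) (aassoc a (b ⊗[V] c) d m))).
rewrite [LHS](fwdK (iso_comp (aassoc a b c _) (aassoc a (b ⊗[V] c) d m))) /=.
rewrite apentagon -(compA _ _ (actm _ _ _ ∘ _)) (compA (actm _ _ _) (actm _ _ _)).
rewrite -actmD fwdK comp1m actm1 comp1m -(compA _ (fwd _)) (compA (fwd _)) fwdK comp1m.
by rewrite -actmD fwdK comp1m actm1.
Qed.

Lemma op_atriangle c m :
  bwd (aassoc a c (unit V) m) ∘ actm a (idm c) (bwd (aunit a m)) =
  actm a (bwd (runit V c)) (idm m).
Proof.
apply: (@iso_monic _ _ _ _
  (iso_comp (actIso a (idIso c) (aunit a m)) (aassoc a c (unit V) m))).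
rewrite [LHS](fwdK (iso_comp (actIso a (idIso c) (aunit a m)) _)) /= atriangle.
by rewrite -actmD fwdK comp1m actm1.
Qed.

Definition opAction : Action (opMon V) (opCat M) :=
  @Build_Action (opCat C) (opMon V) (opCat M) (act a)
    (fun c c' m m' f g => @actm C V M a c' c m' m f g)
    (actm1 a)
    (fun c c' c'' m m' m'' f' g' f g => @actmD C V M a _ _ _ _ _ _ f g f' g')
    (fun c d m => iso_op (aassoc a c d m)) (fun m => iso_op (aunit a m))
    (fun c d m c' d' m' f g h =>
       esym (iso_sq (@aassoc_nat C V M a c' d' m' c d m f g h)))
    (fun m m' h => esym (iso_sq (@aunit_nat C V M a m' m h)))
    op_apentagon op_atriangle.
End OpAction.

Definition unopAction {C : Cat} {W : Monoidal C} {N : Cat} (a : Action (opMon W) N) :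
    Action W (opCat N) :=
  @Build_Action C W (opCat N) (act a)
    (fun c c' m m' f g => @actm (opCat C) (opMon W) N a c' c m' m f g)
    (actm1 a)
    (fun c c' c'' m m' m'' f' g' f g =>
       @actmD (opCat C) (opMon W) N a _ _ _ _ _ _ f g f' g')
    (fun c d m => iso_op (aassoc a c d m)) (fun m => iso_op (aunit a m))
    (fun c d m c' d' m' f g h =>
       esym (iso_sq (@aassoc_nat (opCat C) (opMon W) N a c' d' m' c d m f g h)))
    (fun m m' h => esym (iso_sq (@aunit_nat (opCat C) (opMon W) N a m' m h)))
    (op_apentagon a) (op_atriangle a).

Section ModFunctors.
Context {C : Cat} {V : Monoidal C} {M N : Cat} (a : Action V M) (b : Action V N).

Record LaxModStr (F : Functor M N) := {
  lax : forall c m, hom (c ▷[b] F m) (F (c ▷[a] m));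
  lax_nat : forall c c' m m' (f : hom c c') (g : hom m m'),
    lax c' m' ∘ actm b f (fmap F g) = fmap F (actm a f g) ∘ lax c m;
  lax_assoc : forall c d m,
    fmap F (aassoc a c d m) ∘ lax (c ⊗[V] d) m =
    lax c (d ▷[a] m) ∘ actm b (idm c) (lax d m) ∘ aassoc b c d (F m);
  lax_unit : forall m, fmap F (aunit a m) ∘ lax (unit V) m = aunit b (F m) }.

Record OplaxModStr (F : Functor M N) := {
  oplax : forall c m, hom (F (c ▷[a] m)) (c ▷[b] F m);
  oplax_nat : forall c c' m m' (f : hom c c') (g : hom m m'),
    oplax c' m' ∘ fmap F (actm a f g) = actm b f (fmap F g) ∘ oplax c m;
  oplax_assoc : forall c d m,
    aassoc b c d (F m) ∘ oplax (c ⊗[V] d) m =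
    actm b (idm c) (oplax d m) ∘ oplax c (d ▷[a] m) ∘ fmap F (aassoc a c d m);
  oplax_unit : forall m, aunit b (F m) ∘ oplax (unit V) m = fmap F (aunit a m) }.

Definition lax_strong (F : Functor M N) (S : LaxModStr F) : Prop :=
  forall c m, is_iso (lax S c m).

Definition oplax_strong (F : Functor M N) (S : OplaxModStr F) : Prop :=
  forall c m, is_iso (oplax S c m).

Definition is_module_equivalence (F : Functor M N) (S : LaxModStr F) : Prop :=
  is_equivalence F /\ lax_strong S.

Definition is_oplax_module_equivalence (F : Functor M N) (S : OplaxModStr F) : Prop :=
  is_equivalence F /\ oplax_strong S.

Definition module_equivalent : Prop :=
  exists (F : Functor M N) (S : LaxModStr F), is_module_equivalence S.
End ModFunctors.

Section Algebras.
Context {C : Cat} (V : Monoidal C).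

Record Algebra := {
  alg :> C;
  amul : hom (alg ⊗[V] alg) alg;
  aone : hom (unit V) alg;
  amulA : amul ∘ (amul ⊠[V] idm alg) = amul ∘ (idm alg ⊠[V] amul) ∘ assoc V alg alg alg;
  amul1l : amul ∘ (aone ⊠[V] idm alg) = lunit V alg;
  amul1r : amul ∘ (idm alg ⊠[V] aone) = runit V alg }.

Section RightModules.
Context (A : Algebra).

Record RMod := {
  rmod :> C;
  ract : hom (rmod ⊗[V] A) rmod;
  ractA : ract ∘ (ract ⊠[V] idm A) = ract ∘ (idm rmod ⊠[V] amul A) ∘ assoc V rmod A A;
  ract1 : ract ∘ (idm rmod ⊠[V] aone A) = runit V rmod }.

Definition rmod_linear (x y : RMod) (f : hom (rmod x) (rmod y)) : Prop :=
  f ∘ ract x = ract y ∘ (f ⊠[V] idm (alg A)).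

Definition rmod_hom (x y : RMod) := {f : hom (rmod x) (rmod y) | rmod_linear f}.

Lemma rmod_hom_inj (x y : RMod) (f g : rmod_hom x y) : sval f = sval g -> f = g.
Proof.
case: f g => [f Hf] [g Hg] /= E; case: g / E Hg => Hg.
by rewrite (proof_irrelevance _ Hf Hg).
Qed.

Lemma rmod_id_linear (x : RMod) : rmod_linear (x := x) (idm (rmod x)).
Proof. by rewrite /rmod_linear tensm1 comp1m compm1. Qed.

Lemma rmod_comp_linear (x y z : RMod) (g : rmod_hom y z) (f : rmod_hom x y) :
  rmod_linear (sval g ∘ sval f).
Proof.
case: g f => [g Hg] [f Hf] /=.
rewrite /rmod_linear -compA Hf compA Hg -compA -tensmD comp1m.
by [].
Qed.

Definition rmod_id (x : RMod) : rmod_hom x x := exist _ _ (rmod_id_linear x).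
Definition rmod_comp (x y z : RMod) (g : rmod_hom y z) (f : rmod_hom x y) : rmod_hom x z :=
  exist _ _ (rmod_comp_linear g f).

Lemma rmod_compA (x y z w : RMod) (h : rmod_hom z w) (g : rmod_hom y z)
  (f : rmod_hom x y) : rmod_comp h (rmod_comp g f) = rmod_comp (rmod_comp h g) f.
Proof. by apply: rmod_hom_inj; rewrite /= compA. Qed.

Lemma rmod_comp1m (x y : RMod) (f : rmod_hom x y) : rmod_comp (rmod_id y) f = f.
Proof. by apply: rmod_hom_inj; rewrite /= comp1m. Qed.

Lemma rmod_compm1 (x y : RMod) (f : rmod_hom x y) : rmod_comp f (rmod_id x) = f.
Proof. by apply: rmod_hom_inj; rewrite /= compm1. Qed.

Definition modCat : Cat :=
  {| ob := RMod; hom := rmod_hom; idm := rmod_id; comp := rmod_comp;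
     compA := rmod_compA; comp1m := rmod_comp1m; compm1 := rmod_compm1 |}.

Definition ma_ract (c : C) (x : RMod) : hom ((c ⊗[V] rmod x) ⊗[V] A) (c ⊗[V] rmod x) :=
  (idm c ⊠[V] ract x) ∘ assoc V c (rmod x) A.

Lemma tensm_compr (c x y z : C) (g : hom y z) (f : hom x y) :
  idm c ⊠[V] (g ∘ f) = (idm c ⊠[V] g) ∘ (idm c ⊠[V] f).
Proof. by rewrite -tensmD comp1m. Qed.

Lemma tensm_compl (c x y z : C) (g : hom y z) (f : hom x y) :
  (g ∘ f) ⊠[V] idm c = (g ⊠[V] idm c) ∘ (f ⊠[V] idm c).
Proof. by rewrite -tensmD comp1m. Qed.

Lemma runit_assoc (x y : C) :
  (idm x ⊠[V] runit V y) ∘ assoc V x y (unit V) = runit V (x ⊗[V] y).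
Proof.
have /= <- := aunit_assoc (regAction (revOp (opMon V))) y x.
by rewrite -compA bwdK compm1.
Qed.

Lemma ma_ractA (c : C) (x : RMod) :
  ma_ract c x ∘ (ma_ract c x ⊠[V] idm (alg A)) =
  ma_ract c x ∘ (idm (c ⊗[V] rmod x) ⊠[V] amul A) ∘ assoc V (c ⊗[V] rmod x) A A.
Proof.
rewrite /ma_ract tensm_compl !compA (pre2 _ (assoc_nat V _ _ _)) compA.
rewrite -tensm_compr ractA !tensm_compr -!compA (compA _ (assoc V c _ _)) -pentagon.
rewrite (compA (_ ⊠[V] (_ ⊠[V] _)) (assoc V _ _ _)) -assoc_nat tensm1.
by rewrite !compA.
Qed.

Lemma ma_ract1 (c : C) (x : RMod) :
  ma_ract c x ∘ (idm (c ⊗[V] rmod x) ⊠[V] aone A) = runit V (c ⊗[V] rmod x).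
Proof.
rewrite /ma_ract -tensm1 -compA assoc_nat compA -tensm_compr ract1.
exact: runit_assoc.
Qed.

Definition ma_act (c : C) (x : RMod) : RMod :=
  {| rmod := c ⊗[V] rmod x; ract := ma_ract c x;
     ractA := ma_ractA c x; ract1 := ma_ract1 c x |}.

Lemma ma_map_linear (c c' : C) (x x' : RMod) (f : hom c c') (g : rmod_hom x x') :
  @rmod_linear (ma_act c x) (ma_act c' x') (f ⊠[V] sval g).
Proof.
case: g => [g Hg]; rewrite /rmod_linear /= /ma_ract compA -tensmD compm1 Hg.
by rewrite -compA assoc_nat compA -tensmD comp1m.
Qed.

Definition ma_map (c c' : C) (x x' : RMod) (f : hom c c') (g : rmod_hom x x') :
  rmod_hom (ma_act c x) (ma_act c' x') := exist _ _ (ma_map_linear f g).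

Lemma rmod_inv_linear (x y : RMod) (f : Iso (rmod x) (rmod y)) :
  @rmod_linear x y f -> @rmod_linear y x (bwd f).
Proof.
rewrite /rmod_linear => Hf; apply: (@iso_monic _ _ _ _ f).
rewrite !compA fwdK comp1m Hf -compA -tensmD fwdK comp1m tensm1.
by rewrite compm1.
Qed.

Definition rmodIso (x y : RMod) (f : Iso (rmod x) (rmod y)) (Hf : @rmod_linear x y f) :
    @Iso modCat x y :=
  @Build_Iso modCat x y (exist _ (fwd f) Hf) (exist _ (bwd f) (rmod_inv_linear Hf))
    (@rmod_hom_inj x x (rmod_comp (exist _ (bwd f) (rmod_inv_linear Hf)) (exist _ (fwd f) Hf))
       (rmod_id x) (bwdK f))
    (@rmod_hom_inj y y (rmod_comp (exist _ (fwd f) Hf) (exist _ (bwd f) (rmod_inv_linear Hf)))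
       (rmod_id y) (fwdK f)).

Lemma ma_assoc_linear (c d : C) (x : RMod) :
  @rmod_linear (ma_act (c ⊗[V] d) x) (ma_act c (ma_act d x)) (assoc V c d (rmod x)).
Proof.
rewrite /rmod_linear /= /ma_ract /= /ma_ract -tensm1 compA assoc_nat -compA pentagon.
by rewrite tensm_compr !compA.
Qed.

Lemma ma_unit_linear (x : RMod) :
  @rmod_linear (ma_act (unit V) x) x (lunit V (rmod x)).
Proof.
rewrite /rmod_linear /= /ma_ract compA lunit_nat -compA; congr (_ ∘ _).
exact: (aunit_assoc (regAction V)).
Qed.

Definition modAct : Action V modCat.
Proof.
refine (@Build_Action C V modCat ma_act ma_map _ _
  (fun c d x => rmodIso (ma_assoc_linear c d x))
  (fun x => rmodIso (ma_unit_linear x)) _ _ _ _).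
- by move=> c x; apply: rmod_hom_inj; exact: tensm1.
- by move=> *; apply: rmod_hom_inj; exact: tensmD.
- by move=> *; apply: rmod_hom_inj; exact: assoc_nat.
- by move=> *; apply: rmod_hom_inj; exact: lunit_nat.
- by move=> *; apply: rmod_hom_inj; exact: pentagon.
- by move=> *; apply: rmod_hom_inj; exact: triangle.
Defined.
End RightModules.
End Algebras.

Section InternalHom.
Context {C : Cat} {V : Monoidal C} {M : Cat} (a : Action V M).
Context (iH : forall m : M, RightAdjoint (actR a m)).

Definition ihom (m n : M) : C := iH m n.

Definition iev (m n : M) : hom (ihom m n ▷[a] m) n := counit (iH m) n.

Definition ilift c m n (f : hom (c ▷[a] m) n) : hom c (ihom m n) := lift (iH m) f.

Definition ibr c m n (u : hom c (ihom m n)) : hom (c ▷[a] m) n :=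
  iev m n ∘ actm a u (idm m).

Lemma ibr_inj c m n (u v : hom c (ihom m n)) : ibr u = ibr v -> u = v.
Proof. exact: (@lift_inj _ _ (actR a m) (iH m)). Qed.

Lemma ibr_lift c m n (f : hom (c ▷[a] m) n) : ibr (ilift f) = f.
Proof. exact: (@counit_lift _ _ (actR a m) (iH m)). Qed.

Lemma ibr_nat c c' m n (u : hom c' (ihom m n)) (v : hom c c') :
  ibr (u ∘ v) = ibr u ∘ actm a v (idm m).
Proof. by rewrite /ibr actR_D compA. Qed.

Definition ihomF (m : M) : Functor M C := radjF (iH m).

Lemma ibr_map c m n n' (f : hom n n') (u : hom c (ihom m n)) :
  ibr (fmap (ihomF m) f ∘ u) = f ∘ ibr u.
Proof.
rewrite /ibr actR_D compA.
have -> : iev m n' ∘ actm a (fmap (ihomF m) f) (idm m) = f ∘ iev m n.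
  exact: (@counit_lift _ _ (actR a m) (iH m)).
by rewrite compA.
Qed.

Definition icomp (m n p : M) : hom (ihom n p ⊗[V] ihom m n) (ihom m p) :=
  ilift (iev n p ∘ actm a (idm (ihom n p)) (iev m n) ∘ aassoc a (ihom n p) (ihom m n) m).

Definition iunit (m : M) : hom (unit V) (ihom m m) := ilift (aunit a m).

Lemma ibr_comp m n p x y (u : hom x (ihom n p)) (v : hom y (ihom m n)) :
  ibr (icomp m n p ∘ (u ⊠[V] v)) = ibr u ∘ actm a (idm x) (ibr v) ∘ aassoc a x y m.
Proof.
rewrite ibr_nat ibr_lift -compA aassoc_nat compA; congr (_ ∘ _).
by rewrite /ibr -!compA -!actmD comp1m compm1 comp1m.
Qed.

Lemma ibr_icomp m n p : ibr (icomp m n p) =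
  iev n p ∘ actm a (idm (ihom n p)) (iev m n) ∘ aassoc a (ihom n p) (ihom m n) m.
Proof. exact: ibr_lift. Qed.

Lemma ibr_id m n : ibr (idm (ihom m n)) = iev m n.
Proof. by rewrite /ibr actm1 compm1. Qed.

Lemma icompA m n p q :
  icomp m n q ∘ (icomp n p q ⊠[V] idm (ihom m n)) =
  icomp m p q ∘ (idm (ihom p q) ⊠[V] icomp m n p) ∘ assoc V (ihom p q) (ihom n p) (ihom m n).
Proof.
apply: ibr_inj; rewrite ibr_comp ibr_id ibr_icomp ibr_nat ibr_comp ibr_id ibr_icomp.
have -> : actm a (idm (ihom p q))
    (iev n p ∘ actm a (idm (ihom n p)) (iev m n) ∘ aassoc a (ihom n p) (ihom m n) m)
  = actm a (idm (ihom p q)) (iev n p)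
    ∘ actm a (idm (ihom p q)) (actm a (idm (ihom n p)) (iev m n))
    ∘ actm a (idm (ihom p q)) (aassoc a (ihom n p) (ihom m n) m).
  by rewrite -!actmD !comp1m.
rewrite -!compA (compA (actm a (idm (ihom p q)) (aassoc a _ _ m))) -apentagon.
congr (_ ∘ (_ ∘ _)); rewrite compA (compA (actm a _ (actm a _ _))); congr (_ ∘ _).
by rewrite -tensm1 aassoc_nat.
Qed.

Lemma icomp1l m n : icomp m n n ∘ (iunit n ⊠[V] idm (ihom m n)) = lunit V (ihom m n).
Proof.
apply: ibr_inj; rewrite ibr_comp ibr_id ibr_lift aunit_nat -compA aunit_assoc.
by [].
Qed.

Lemma icomp1r m n : icomp m m n ∘ (idm (ihom m n) ⊠[V] iunit m) = runit V (ihom m n).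
Proof.
by apply: ibr_inj; rewrite ibr_comp ibr_id ibr_lift -compA atriangle.
Qed.

Definition iEnd (m : M) : Algebra V :=
  {| alg := ihom m m; amul := icomp m m m; aone := iunit m;
     amulA := icompA m m m m; amul1l := icomp1l m m; amul1r := icomp1r m m |}.

Definition ilax (m : M) (c : C) (n : M) : hom (c ⊗[V] ihom m n) (ihom m (c ▷[a] n)) :=
  ilift (actm a (idm c) (iev m n) ∘ aassoc a c (ihom m n) m).

Lemma ibr_ilax m c n x y (f : hom x c) (u : hom y (ihom m n)) :
  ibr (ilax m c n ∘ (f ⊠[V] u)) = actm a f (ibr u) ∘ aassoc a x y m.
Proof.
rewrite ibr_nat ibr_lift -compA aassoc_nat compA -actmD comp1m.
by [].
Qed.

Lemma ibr_ilax1 m c n :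
  ibr (ilax m c n) = actm a (idm c) (iev m n) ∘ aassoc a c (ihom m n) m.
Proof. exact: ibr_lift. Qed.

Lemma ilax_nat m c c' n n' (f : hom c c') (g : hom n n') :
  ilax m c' n' ∘ (f ⊠[V] fmap (ihomF m) g) =
  fmap (ihomF m) (actm a f g) ∘ ilax m c n.
Proof.
apply: ibr_inj; rewrite ibr_ilax ibr_map ibr_ilax1 compA -actmD compm1.
by rewrite -(compm1 (fmap (ihomF m) g)) ibr_map ibr_id.
Qed.

Lemma ilax_assoc m c d n :
  fmap (ihomF m) (aassoc a c d n) ∘ ilax m (c ⊗[V] d) n =
  ilax m c (d ▷[a] n) ∘ (idm c ⊠[V] ilax m d n) ∘ assoc V c d (ihom m n).
Proof.
apply: ibr_inj; rewrite ibr_map ibr_ilax1 ibr_nat ibr_ilax ibr_ilax1.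
rewrite -tensm1 compA aassoc_nat actF_D -!compA.
by rewrite apentagon -!compA.
Qed.

Lemma ilax_unit m n : fmap (ihomF m) (aunit a n) ∘ ilax m (unit V) n = lunit V (ihom m n).
Proof.
apply: ibr_inj; rewrite ibr_map ibr_ilax1 compA aunit_nat -compA aunit_assoc.
by [].
Qed.

Definition ihom_lax (m : M) : LaxModStr a (regAction V) (ihomF m) :=
  @Build_LaxModStr C V M C a (regAction V) (ihomF m) (ilax m)
    (@ilax_nat m) (ilax_assoc m) (ilax_unit m).

(** [Hom(m, n)] as a right [Hom(m, m)]-module, and the resulting lax module
    functor [Hom(m, -)] from [M] to [mod-Hom(m, m)]. *)
Definition cmp_ob (m n : M) : RMod (iEnd m) :=
  @Build_RMod C V (iEnd m) (ihom m n) (icomp m m n) (icompA m m m n) (icomp1r m n).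

Lemma cmp_map_linear m n n' (f : hom n n') :
  @rmod_linear C V (iEnd m) (cmp_ob m n) (cmp_ob m n') (fmap (ihomF m) f).
Proof.
change (fmap (ihomF m) f ∘ icomp m m n =
  icomp m m n' ∘ (fmap (ihomF m) f ⊠[V] idm (ihom m m))).
apply: ibr_inj; rewrite ibr_map ibr_comp !ibr_icomp ibr_id.
by rewrite -(compm1 (fmap (ihomF m) f)) ibr_map ibr_id !compA.
Qed.

Definition cmp_map m n n' (f : hom n n') : rmod_hom (cmp_ob m n) (cmp_ob m n') :=
  exist _ (fmap (ihomF m) f) (cmp_map_linear m f).

Definition comparison (m : M) : Functor M (modCat (iEnd m)) :=
  @Build_Functor M (modCat (iEnd m)) (cmp_ob m) (@cmp_map m)
    (fun n => @rmod_hom_inj _ _ _ (cmp_ob m n) (cmp_ob m n)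
       (cmp_map m (idm n)) (rmod_id _) (fmap1 (ihomF m) n))
    (fun x y z g f => @rmod_hom_inj _ _ _ (cmp_ob m x) (cmp_ob m z)
       (cmp_map m (g ∘ f)) (rmod_comp (cmp_map m g) (cmp_map m f)) (fmapD (ihomF m) g f)).

Lemma cmp_lax_linear m c n :
  @rmod_linear C V (iEnd m) (ma_act c (cmp_ob m n)) (cmp_ob m (c ▷[a] n)) (ilax m c n).
Proof.
rewrite /rmod_linear /= /ma_ract /=.
apply: ibr_inj; rewrite compA ibr_nat ibr_ilax ibr_comp ibr_id ibr_icomp.
rewrite ibr_ilax1 !actF_D -tensm1 (pre2 _ (aassoc_nat a _ _ _)) compA.
by rewrite -!compA apentagon -!compA.
Qed.

Definition cmp_lax m c n : rmod_hom (ma_act c (cmp_ob m n)) (cmp_ob m (c ▷[a] n)) :=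
  exist _ (ilax m c n) (cmp_lax_linear m c n).

Definition comparison_lax (m : M) : LaxModStr a (modAct (iEnd m)) (comparison m).
Proof.
refine (@Build_LaxModStr C V M (modCat (iEnd m)) a (modAct (iEnd m)) (comparison m)
  (cmp_lax m) _ _ _).
- by move=> *; apply: rmod_hom_inj; exact: ilax_nat.
- by move=> *; apply: rmod_hom_inj; exact: ilax_assoc.
- by move=> *; apply: rmod_hom_inj; exact: ilax_unit.
Defined.
End InternalHom.

Definition is_generator (C : Cat) (V : Monoidal C) (M : Cat) (a : Action V M) (m0 : M) :
    Prop :=
  forall m : M, exists (c : C) (p : hom (c ▷[a] m0) m), is_epi p.

Definition is_cogenerator (C : Cat) (W : Monoidal C) (M : Cat) (b : Action W M) (n0 : M) :
    Prop :=
  forall m : M, exists (d : C) (j : hom m (d ▷[b] n0)), is_mono j.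

Definition algebraic (C : Cat) (V : Monoidal C) (M : Cat) (a : Action V M) : Prop :=
  exists A : Algebra V, is_GV_module (modAct A) /\ module_equivalent a (modAct A).

(** The objects [m] of the full subcategory of [M] on which [Hom(m, -)] is a strong
    module functor with a right adjoint. *)
Definition in_hat_tens (C : Cat) (V : Monoidal C) (M : Cat) (a : Action V M)
    (iH : forall m : M, RightAdjoint (actR a m)) (m : M) : Prop :=
  lax_strong (ihom_lax iH m) /\ has_right_adjoint (ihomF iH m).

(** For a module category [M] over [(C, W)], all notions are those of the module
    category [M^op] over [(C, W)^op]: [coHom] is its internal Hom, coalgebras in
    [(C, W)] are algebras in [(C, W)^op], and comodules form the opposite of the
    corresponding module category. *)

Definition Coalgebra (C : Cat) (W : Monoidal C) := Algebra (opMon W).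

Definition comodCat (C : Cat) (W : Monoidal C) (A : Coalgebra W) : Cat := opCat (modCat A).

Definition comodAct (C : Cat) (W : Monoidal C) (A : Coalgebra W) : Action W (comodCat A) :=
  unopAction (modAct A).

Definition unopFun (C D : Cat) (F : Functor (opCat C) D) : Functor C (opCat D) :=
  @Build_Functor C (opCat D) F (fun x y f => @fmap (opCat C) D F y x f)
    (fun x => fmap1 F x) (fun x y z g f => @fmapD (opCat C) D F z y x f g).

Lemma fmap_isoK (C D : Cat) (F : Functor C D) (x y : C) (f : Iso x y) :
  fmap F (bwd f) ∘ fmap F f = idm (F x).
Proof. by rewrite -fmapD bwdK fmap1. Qed.

Definition fmap_iso (C D : Cat) (F : Functor C D) (x y : C) (f : Iso x y) :
    Iso (F x) (F y) :=
  {| fwd := fmap F f; bwd := fmap F (bwd f);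
     bwdK := fmap_isoK F f; fwdK := fmap_isoK F (iso_inv f) |}.

Section InternalCoHom.
Context {C : Cat} {W : Monoidal C} {M : Cat} (b : Action W M).
Context (cH : forall m : M, LeftAdjoint (actR b m)).

Definition cohom (m n : M) : C := cH m n.

Definition cohomF (m : M) : Functor M C :=
  @Build_Functor M C (cohom m) (fun x y f => @fmap (opCat M) (opCat C) (radjF (cH m)) y x f)
    (fun x => fmap1 (radjF (cH m)) x)
    (fun x y z g f => @fmapD (opCat M) (opCat C) (radjF (cH m)) z y x f g).

(** [cH m], seen as an internal Hom of the opposite module category. *)
Definition opH (m : opCat M) : RightAdjoint (actR (opAction b) m) :=
  @Build_RightAdjoint (opCat C) (opCat M) (actR (opAction b) m) (radj (cH m))
    (counit (cH m)) (@lift _ _ _ (cH m))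
    (@counit_lift _ _ _ (cH m)) (@lift_counit _ _ _ (cH m)).

(** The coalgebra [coHom(m, m)], with internal cocomposition. *)
Definition coEnd (m : M) : Coalgebra W := iEnd opH m.

Definition cohom_oplax_map (m : M) (c : C) (n : M) :
    hom (cohom m (c ▷[b] n)) (c ⊗[W] cohom m n) := ilax opH m c n.

Lemma cohom_oplax_nat m c c' n n' (f : hom c c') (g : hom n n') :
  cohom_oplax_map m c' n' ∘ fmap (cohomF m) (actm b f g) =
  (f ⊠[W] fmap (cohomF m) g) ∘ cohom_oplax_map m c n.
Proof. exact: esym (@ilax_nat _ _ _ _ opH m c' c n' n f g). Qed.

Lemma cohom_oplax_assoc m c d n :
  assoc W c d (cohom m n) ∘ cohom_oplax_map m (c ⊗[W] d) n =
  (idm c ⊠[W] cohom_oplax_map m d n) ∘ cohom_oplax_map m c (d ▷[b] n)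
    ∘ fmap (cohomF m) (aassoc b c d n).
Proof.
apply: (@iso_sq C _ _ _ _ (iso_inv (fmap_iso (cohomF m) (aassoc b c d n)))
  (iso_inv (assoc W c d (cohom m n)))).
exact: esym (@ilax_assoc _ _ _ _ opH m c d n).
Qed.

Lemma cohom_oplax_unit m n :
  lunit W (cohom m n) ∘ cohom_oplax_map m (unit W) n = fmap (cohomF m) (aunit b n).
Proof.
rewrite -[RHS]comp1m.
apply: (@iso_sq C _ _ _ _ (iso_inv (fmap_iso (cohomF m) (aunit b n)))
  (iso_inv (lunit W (cohom m n)))).
rewrite compm1; exact: esym (@ilax_unit _ _ _ _ opH m n).
Qed.

Definition cohom_oplax (m : M) : OplaxModStr b (regAction W) (cohomF m) :=
  @Build_OplaxModStr C W M C b (regAction W) (cohomF m) (cohom_oplax_map m)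
    (@cohom_oplax_nat m) (cohom_oplax_assoc m) (cohom_oplax_unit m).

(** The objects [m] of the full subcategory of [M] on which [coHom(m, -)] is a
    strong module functor with a left adjoint. *)
Definition in_hat_odot (m : M) : Prop :=
  oplax_strong (cohom_oplax m) /\ has_left_adjoint (cohomF m).
End InternalCoHom.

Section UnopLax.
Context {C : Cat} {W : Monoidal C} {M N : Cat} (b : Action W M) (b' : Action (opMon W) N).
Context (F : Functor (opCat M) N) (S : LaxModStr (opAction b) b' F).

Definition unop_lax_map (c : C) (m : M) :
  @hom (opCat N) (unopFun F (c ▷[b] m)) (c ▷[unopAction b'] unopFun F m) := lax S c m.

Lemma unop_lax_nat c c' m m' (f : hom c c') (g : hom m m') :
  unop_lax_map c' m' ∘ fmap (unopFun F) (actm b f g) =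
  actm (unopAction b') f (fmap (unopFun F) g) ∘ unop_lax_map c m.
Proof. exact: esym (@lax_nat _ _ _ _ _ _ _ S c' c m' m f g). Qed.

Lemma unop_lax_assoc c d m :
  aassoc (unopAction b') c d (unopFun F m) ∘ unop_lax_map (c ⊗[W] d) m =
  actm (unopAction b') (idm c) (unop_lax_map d m) ∘ unop_lax_map c (d ▷[b] m)
    ∘ fmap (unopFun F) (aassoc b c d m).
Proof.
apply: esym.
apply: (@iso_sq N _ _ _ _ (aassoc b' c d (F m)) (fmap_iso F (iso_op (aassoc b c d m)))).
exact: (@lax_assoc _ _ _ _ _ _ _ S c d m).
Qed.

Lemma unop_lax_unit m :
  aunit (unopAction b') (unopFun F m) ∘ unop_lax_map (unit W) m =
  fmap (unopFun F) (aunit b m).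
Proof.
apply: esym; rewrite -[LHS]comp1m.
apply: (@iso_sq N _ _ _ _ (aunit b' (F m)) (fmap_iso F (iso_op (aunit b m)))).
rewrite comp1m; exact: (@lax_unit _ _ _ _ _ _ _ S m).
Qed.

Definition unop_lax : OplaxModStr b (unopAction b') (unopFun F) :=
  @Build_OplaxModStr C W M (opCat N) b (unopAction b') (unopFun F) unop_lax_map
    unop_lax_nat unop_lax_assoc unop_lax_unit.
End UnopLax.

Section CoComparison.
Context {C : Cat} {W : Monoidal C} {M : Cat} (b : Action W M).
Context (cH : forall m : M, LeftAdjoint (actR b m)).

Definition cocomparison (m : M) : Functor M (comodCat (coEnd cH m)) :=
  unopFun (comparison (opH cH) m).

Definition cocomparison_oplax (m : M) :
    OplaxModStr b (comodAct (coEnd cH m)) (cocomparison m) :=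
  unop_lax (comparison_lax (opH cH) m).
End CoComparison.

(** Existence of internal coHoms: [coHom(m, n) = G^-1 Hom(n, m)]. *)
Section CoHomExists.
Context (C : GVCat) (M : Cat) (a : Action (gv_mon C) M).
Context (R : forall c : C, RightAdjoint (actF a (gvG c))).
Context (iH : forall m : M, RightAdjoint (actR a m)).

Local Notation G := (dGF (gv_dual C)).
Local Notation E := (gv_inv C).
Local Notation b := (blackAction R).

Definition ch_ob (m n : M) : C := qinv E (ihom iH n m).
Definition ch_iso m n : Iso (gvG (ch_ob m n)) (ihom iH n m) := ecounit E (ihom iH n m).

Definition ch_counit (m n : M) : hom n (ch_ob m n ▷[b] m) :=
  lift (R (ch_ob m n)) (ibr (ch_iso m n)).

Definition ch_lift (m n : M) (c : C) (f : hom n (c ▷[b] m)) : hom (ch_ob m n) c :=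
  @preim (opCat C) C G E c (ch_ob m n)
    (bwd (ch_iso m n)
     ∘ ilift iH (counit (R c) m ∘ actm a (idm (gvG c)) (f : hom n (R c m)))).

Lemma ch_br_act m c c' n (g : hom c c') (u : hom n (R c m)) :
  counit (R c') m ∘ actm a (idm (gvG c')) (actm b g (idm m) ∘ u : hom n (R c' m)) =
  counit (R c) m ∘ actm a (idm (gvG c)) u ∘ actm a (dG_map _ g) (idm n).
Proof.
have := @aa_br_map _ _ _ _ (fun c : opCat C => pull_radj (gvG_strong C) (R c))
  c c' m m g (idm m) n u.
rewrite comp1m /aa_br /= /pull_map -/(gvG c) -/(gvG c').
have E1 (x : C) : fmap G (@idm (opCat C) x) = idm (gvG x) by exact: (fmap1 G).
by rewrite !E1.
Qed.

Lemma ch_br_counit m n c (g : hom (ch_ob m n) c) :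
  counit (R c) m ∘ actm a (idm (gvG c)) (actm b g (idm m) ∘ ch_counit m n : hom n (R c m))
  = ibr (ch_iso m n ∘ dG_map _ g).
Proof.
rewrite ch_br_act ibr_nat; congr (_ ∘ _).
exact: (@counit_lift _ _ (actF a (gvG (ch_ob m n))) (R (ch_ob m n))).
Qed.

Lemma ch_lift_map m n c (f : hom n (c ▷[b] m)) :
  dG_map _ (ch_lift f) = bwd (ch_iso m n)
     ∘ ilift iH (counit (R c) m ∘ actm a (idm (gvG c)) (f : hom n (R c m))).
Proof. exact: (@preimK (opCat C) C G E). Qed.

Lemma ch_counit_lift m n c (f : hom n (c ▷[b] m)) :
  actm b (ch_lift f) (idm m) ∘ ch_counit m n = f.
Proof.
apply: (@lift_inj _ _ (actF a (gvG c)) (R c) n m).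
rewrite [LHS]ch_br_counit ch_lift_map compA fwdK comp1m.
exact: ibr_lift.
Qed.

Lemma ch_lift_counit m n c (g : hom (ch_ob m n) c) :
  ch_lift (actm b g (idm m) ∘ ch_counit m n) = g.
Proof.
apply: (@equiv_faithful (opCat C) C G E).
rewrite [LHS]ch_lift_map ch_br_counit.
have -> : ilift iH (ibr (ch_iso m n ∘ dG_map (gv_dual C) g))
  = ch_iso m n ∘ dG_map (gv_dual C) g.
  exact: (@lift_counit _ _ (actR a n) (iH n)).
by rewrite compA bwdK comp1m.
Qed.

Definition cohom_exists (m : M) : LeftAdjoint (actR b m) :=
  @Build_RightAdjoint (opCat C) (opCat M) (opFun (actR b m)) (ch_ob m) (ch_counit m)
    (fun c n f => ch_lift f) (fun c n f => ch_counit_lift f)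
    (fun c n g => ch_lift_counit g).
End CoHomExists.

(* Main.v *)
From mathcomp Require Import all_boot all_algebra.
From Stdlib Require Import ClassicalEpsilon.
Require Import Defs.

(** The theorem is Beck's monadicity theorem for the functor [H = Hom(m, -)], which is
    right adjoint to [- ▷ m : C → M].

    If [M] is identified with [mod-A] by a strong module functor [F] and [F m] is the
    regular module [A], then the free modules [c ⊗ A] correspond to the objects [c ▷ m].
    So [H] is the composite of [F] with the forgetful functor to [C], and the lax structure
    of [H] is the one inherited from [F]: it is invertible. The forgetful functor has a
    right adjoint, the cofree module, as soon as [- ⊗ A] has one, which holds in a
    GV-category since [Hom (x ⊗ y, G w) = Hom (x, G (y ⊗ w))]. Finally [H] is faithful,
    which says that the evaluations [Hom(m, n) ▷ m → n] are epimorphisms, so that [m]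
    generates. This is [algebra_object_in_hat].

    Conversely, let [m] be a generator such that [H] is strong and has a right adjoint.
    Strength identifies the monad [Hom(m, - ▷ m)] with [- ⊗ Hom(m, m)], hence its modules
    with [mod-Hom(m, m)]. The functor [H] preserves coequalizers because it has a right
    adjoint, and it reflects isomorphisms because it is faithful and [M] is balanced. A
    module [X] is therefore recovered as [H Q], where [Q] is the coequalizer of the two
    actions on [X ▷ m]; this is [bar_coequalizer], and it gives essential surjectivity as
    well as fullness of the comparison functor. All that is used of [M] is that it has
    coequalizers and is balanced. That [mod-Hom(m, m)] is again a GV-module category
    follows by transport from [M].

    These two conditions on [M] hold for abelian categories. For a finite category they are
    checked on finite-dimensional modules and transported along the equivalence; the
    opposite category satisfies them as well. Comodules and internal coHoms are modules and
    internal Homs of the opposite module category, so the dual statement is the same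
    equivalence for [M^op] over [(C, ⊙)^op], once [- ⊙ c] is known to have a left adjoint.
    It has one because [G] turns it into [G c ⊗ -], whose right adjoint is again computed
    from the duality ([odot_closed]). *)

Set Implicit Arguments.
Unset Strict Implicit.
Unset Printing Implicit Defensive.

Local Open Scope cat_scope.

(** * Universal arrows and adjoints *)

Lemma iso_is_iso (C : Cat) (x y : C) (f : Iso x y) : is_iso f.
Proof. by exists (bwd f); rewrite bwdK fwdK. Qed.

Lemma is_iso_Iso (C : Cat) (x y : C) (f : hom x y) :
  is_iso f -> exists i : Iso x y, fwd i = f.
Proof. by case=> g [gf fg]; exists (Build_Iso gf fg). Qed.

Lemma is_iso_comp (C : Cat) (x y z : C) (g : hom y z) (f : hom x y) :
  is_iso g -> is_iso f -> is_iso (g ∘ f).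
Proof.
by move=> /is_iso_Iso[i <-] /is_iso_Iso[j <-]; apply: (iso_is_iso (iso_comp i j)).
Qed.

Definition universal (C D : Cat) (F : Functor C D) (r : C) (d : D) (u : hom (F r) d) :
    Prop :=
  forall c (f : hom (F c) d), exists! g : hom c r, u ∘ fmap F g = f.

Definition has_universal (C D : Cat) (F : Functor C D) (d : D) : Prop :=
  exists (r : C) (u : hom (F r) d), universal u.

Lemma counit_universal (C D : Cat) (F : Functor C D) (R : RightAdjoint F) d :
  universal (counit R d).
Proof.
move=> c f; exists (lift R f); split; first exact: counit_lift.
by move=> g <-; apply: lift_counit.
Qed.

Lemma has_right_adjoint_universal (C D : Cat) (F : Functor C D) (d : D) :
  has_right_adjoint F -> has_universal F d.
Proof. by case=> R; exists (R d), (counit R d); apply: counit_universal. Qed.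

(** The chosen universal arrows assemble to an adjoint only through the axiom of
    choice, the objects [r] being given by mere existence. *)
Lemma universal_right_adjoint (C D : Cat) (F : Functor C D) :
  (forall d, has_universal F d) -> has_right_adjoint F.
Proof.
move=> ex.
have U d : {r : C & {u : hom (F r) d | universal u}}.
  case/constructive_indefinite_description: (ex d) => r.
  by case/constructive_indefinite_description=> u Hu; exists r; exists u.
pose u d : hom (F (projT1 (U d))) d := sval (projT2 (U d)).
have Hu d : universal (u d) := svalP (projT2 (U d)).
have L c d (f : hom (F c) d) : {g : hom c (projT1 (U d)) | u d ∘ fmap F g = f}.
  by apply: constructive_indefinite_description; case: (Hu d c f) => g [? _]; exists g.
constructor.
refine (@Build_RightAdjoint C D F (fun d => projT1 (U d)) u
  (fun c d f => sval (L c d f)) (fun c d f => svalP (L c d f)) _).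
move=> c d g; have [h [_ Uh]] := Hu d c (u d ∘ fmap F g).
by apply: etrans (Uh g erefl); apply/esym/Uh/(svalP (L c d _)).
Qed.

Lemma universal_inj (C D : Cat) (F : Functor C D) (r : C) (d : D) (u : hom (F r) d) :
  universal u -> forall c (g g' : hom c r), u ∘ fmap F g = u ∘ fmap F g' -> g = g'.
Proof.
by move=> Hu c g g' E; have [h [_ Uh]] := Hu c (u ∘ fmap F g'); rewrite -(Uh g E) (Uh g').
Qed.

(** Representability is invariant under a natural bijection of presheaves. *)
Lemma has_universal_transfer (C D D' : Cat) (F : Functor C D) (F' : Functor C D')
    (d : D) (d' : D') (t : forall c, hom (F' c) d' -> hom (F c) d) :
  (forall c c' (g : hom c c') h, t c (h ∘ fmap F' g) = t c' h ∘ fmap F g) ->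
  (forall c, injective (t c)) ->
  (forall c f, exists h, t c h = f) ->
  has_universal F' d' -> has_universal F d.
Proof.
move=> t_nat t_inj t_surj [r [u Hu]]; exists r, (t r u) => c f.
have [h <-] := t_surj c f; have [g [Eg Ug]] := Hu c h.
exists g; split; first by rewrite -t_nat Eg.
by move=> g'; rewrite -t_nat => /t_inj; apply: Ug.
Qed.

Lemma has_right_adjoint_comp (C D E : Cat) (G : Functor D E) (F : Functor C D) :
  has_right_adjoint G -> has_right_adjoint F -> has_right_adjoint (compF G F).
Proof.
move=> [S] [R]; apply: universal_right_adjoint => e.
exists (R (S e)), (counit S e ∘ fmap G (counit R (S e))) => c f.
exists (lift R (lift S f)); split.
  by rewrite /= -compA -fmapD !counit_lift.
by move=> g; rewrite /= -compA -fmapD => <-; rewrite !lift_counit.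
Qed.

Lemma has_right_adjoint_natiso (C D : Cat) (F F' : Functor C D) (i : NatIso F F') :
  has_right_adjoint F -> has_right_adjoint F'.
Proof.
move=> Rf; apply: universal_right_adjoint => d.
have := @has_right_adjoint_universal _ _ _ d Rf.
apply: (has_universal_transfer (t := fun c h => h ∘ bwd (i c))).
- move=> c c' g h; rewrite -!compA; congr (_ ∘ _).
  by apply/esym/iso_sq; rewrite nnat.
- by move=> c; apply: (iso_epic (i := iso_inv (i c))).
- by move=> c f; exists (f ∘ i c); rewrite -compA fwdK compm1.
Qed.

(** * Equivalences *)

Definition faithful (C D : Cat) (F : Functor C D) : Prop :=
  forall x y (f g : hom x y), fmap F f = fmap F g -> f = g.

Definition full (C D : Cat) (F : Functor C D) : Prop :=
  forall x y (g : hom (F x) (F y)), exists f, fmap F f = g.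

Definition ess_surj (C D : Cat) (F : Functor C D) : Prop :=
  forall d, exists c, inhabited (Iso (F c) d).

Lemma equivalence_faithful (C D : Cat) (F : Functor C D) : is_equivalence F -> faithful F.
Proof. by case=> E x y f g; apply: equiv_faithful. Qed.

Lemma equivalence_full (C D : Cat) (F : Functor C D) : is_equivalence F -> full F.
Proof. by case=> E x y g; exists (preim E g); apply: preimK. Qed.

Lemma equivalence_ess_surj (C D : Cat) (F : Functor C D) : is_equivalence F -> ess_surj F.
Proof. by case=> E d; exists (qinv E d); constructor; apply: (ecounit E d). Qed.

Lemma ff_is_iso (C D : Cat) (F : Functor C D) (x y : C) (f : hom x y) :
  faithful F -> full F -> is_iso (fmap F f) -> is_iso f.
Proof.
move=> Ff Fl [g [gf fg]]; have [h Eh] := Fl _ _ g; exists h.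
by split; apply: Ff; rewrite fmapD Eh fmap1.
Qed.

(** The quasi-inverse is assembled by the axiom of choice. *)
Lemma ff_eso_equivalence (C D : Cat) (F : Functor C D) :
  faithful F -> full F -> ess_surj F -> is_equivalence F.
Proof.
move=> Ff Fl Es.
have Q d : {c : C & Iso (F c) d}.
  case/constructive_indefinite_description: (Es d) => c Hc; exists c.
  have H : exists i : Iso (F c) d, True by case: Hc => i; exists i.
  by case/constructive_indefinite_description: H.
have P x y (g : hom (F x) (F y)) : {f | fmap F f = g}.
  exact: constructive_indefinite_description (Fl x y g).
pose q d := projT1 (Q d); pose i d : Iso (F (q d)) d := projT2 (Q d).
pose p x y g : hom x y := sval (P x y g).
have pE x y g : fmap F (p x y g) = g := svalP (P x y g).
pose qm d d' (f : hom d d') : hom (q d) (q d') := p _ _ (bwd (i d') ∘ f ∘ i d).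
have qm1 d : qm d d (idm d) = idm (q d).
  by apply: Ff; rewrite pE fmap1 compm1 bwdK.
have qmD x y z (g : hom y z) (f : hom x y) : qm x z (g ∘ f) = qm y z g ∘ qm x y f.
  apply: Ff; rewrite fmapD !pE -!compA; congr (_ ∘ (_ ∘ _)).
  by rewrite compA fwdK comp1m.
pose qF := Build_Functor qm1 qmD.
have uK1 x : p _ _ (i (F x) : hom _ _) ∘ p x (q (F x)) (bwd (i (F x))) = idm x.
  by apply: Ff; rewrite fmapD !pE fwdK fmap1.
have uK2 x : p x (q (F x)) (bwd (i (F x))) ∘ p _ _ (i (F x) : hom _ _) = idm _.
  by apply: Ff; rewrite fmapD !pE bwdK fmap1.
pose un x : Iso (idF C x) (compF qF F x) := Build_Iso (uK1 x) (uK2 x).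
have un_nat x y (f : hom x y) : un y ∘ fmap (idF C) f = fmap (compF qF F) f ∘ un x.
  apply: Ff; rewrite !fmapD /= !pE -!compA; congr (_ ∘ _).
  by rewrite fwdK compm1.
have co_nat x y (f : hom x y) : i y ∘ fmap (compF F qF) f = fmap (idF D) f ∘ i x.
  by rewrite /= pE !compA fwdK comp1m.
constructor; exact: (@Build_Equivalence C D F qF (Build_NatIso un_nat)
  (@Build_NatIso D D (compF F qF) (idF D) i co_nat)).
Qed.

Lemma equivalence_right_adjoint (C D : Cat) (F : Functor C D) :
  is_equivalence F -> has_right_adjoint F.
Proof.
case=> E; apply: universal_right_adjoint => d.
exists (qinv E d), (ecounit E d) => c f.
exists (preim E (bwd (ecounit E d) ∘ f)); split.
  by rewrite preimK compA (fwdK (ecounit E d)) comp1m.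
move=> g <-; apply: (equiv_faithful E); rewrite preimK compA (bwdK (ecounit E d)).
by rewrite comp1m.
Qed.

Lemma qinv_equivalence (C D : Cat) (F : Functor C D) (E : Equivalence F) :
  is_equivalence (qinv E).
Proof.
apply: ff_eso_equivalence.
- by move=> x y f g; apply: qinv_faithful.
- move=> x y g; exists (ecounit E y ∘ fmap F g ∘ bwd (ecounit E x)).
  apply: (equiv_faithful E); apply: (iso_monic (i := ecounit E y)).
  have /= -> := nnat (ecounit E) (ecounit E y ∘ fmap F g ∘ bwd (ecounit E x)).
  by rewrite -!compA (bwdK (ecounit E x)) compm1.
- by move=> c; exists (F c); constructor; apply: (iso_inv (eunit E c)).
Qed.

Lemma opFun_equivalence (C D : Cat) (F : Functor C D) :
  is_equivalence F -> is_equivalence (opFun F).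
Proof.
move=> E; apply: ff_eso_equivalence.
- by move=> x y; apply: (equivalence_faithful E).
- by move=> x y; apply: (equivalence_full E).
- move=> d; have [c [i]] := equivalence_ess_surj E d.
  by exists c; constructor; apply: iso_op.
Qed.

(** * Modules over an algebra *)

Lemma tensm_lr (C : Cat) (V : Monoidal C) (a a' b b' : C) (f : hom a a') (g : hom b b') :
  (f ⊠[V] idm b') ∘ (idm a ⊠[V] g) = f ⊠[V] g.
Proof. by rewrite -tensmD comp1m compm1. Qed.

Lemma tensm_rl (C : Cat) (V : Monoidal C) (a a' b b' : C) (f : hom a a') (g : hom b b') :
  (idm a' ⊠[V] g) ∘ (f ⊠[V] idm b) = f ⊠[V] g.
Proof. by rewrite -tensmD comp1m compm1. Qed.

Section Modules.
Context {C : Cat} {V : Monoidal C} (A : Algebra V).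

Definition forget : Functor (modCat A) C :=
  @Build_Functor (modCat A) C (@rmod C V A) (fun x y (f : rmod_hom x y) => sval f)
    (fun=> erefl) (fun _ _ _ _ _ => erefl).

Definition regMod : RMod A := @Build_RMod C V A A (amul A) (amulA A) (amul1r A).

Lemma runit_inv_nat (x y : C) (f : hom x y) :
  (f ⊠[V] idm (unit V)) ∘ bwd (runit V x) = bwd (runit V y) ∘ f.
Proof. by apply/esym/iso_sq; rewrite runit_nat. Qed.

(** [c ⊗ A] is the free module on [c]: its linear maps to [N] amount to maps from [c]
    to [N], through restriction along the unit of [A]. *)
Definition restr (c : C) (N : RMod A) (u : hom (ma_act c regMod) (rmod N)) :
    hom c (rmod N) :=
  u ∘ (idm c ⊠[V] aone A) ∘ bwd (runit V c).

Lemma free_map_linear (c : C) (N : RMod A) (h : hom c (rmod N)) :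
  @rmod_linear C V A (ma_act c regMod) N (ract N ∘ (h ⊠[V] idm (alg A))).
Proof.
rewrite /rmod_linear /= /ma_ract /= tensm_compl !compA ractA -!compA; congr (_ ∘ _).
rewrite assoc_nat tensm1 !compA; congr (_ ∘ _).
by rewrite -!tensmD !comp1m !compm1.
Qed.

Lemma restr_free_map (c : C) (N : RMod A) (h : hom c (rmod N)) :
  restr (N := N) (ract N ∘ (h ⊠[V] idm (alg A))) = h.
Proof.
rewrite /restr -(compA (ract N)) -tensmD compm1 comp1m.
have -> : h ⊠[V] aone A = (idm _ ⊠[V] aone A) ∘ (h ⊠[V] idm (unit V)).
  by rewrite -tensmD compm1 comp1m.
by rewrite compA ract1 -compA runit_inv_nat compA fwdK comp1m.
Qed.

Lemma linear_free_map (c : C) (N : RMod A) (u : hom (c ⊗[V] A) (rmod N)) :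
  @rmod_linear C V A (ma_act c regMod) N u ->
  ract N ∘ (restr (N := N) u ⊠[V] idm (alg A)) = u.
Proof.
rewrite /rmod_linear /= /ma_ract /= => Hu; rewrite /restr !tensm_compl !compA -Hu.
rewrite -!compA (compA (fwd (assoc V _ _ _))) assoc_nat -compA.
rewrite triangle_inv !compA -(compA u) -tensm_compr amul1l.
by rewrite -compA -tensm_compr fwdK tensm1 compm1.
Qed.

Lemma restr_inj (c : C) (N : RMod A) (u v : hom (c ⊗[V] A) (rmod N)) :
  @rmod_linear C V A (ma_act c regMod) N u -> @rmod_linear C V A (ma_act c regMod) N v ->
  restr (N := N) u = restr (N := N) v -> u = v.
Proof. by move=> Hu Hv E; rewrite -(linear_free_map Hu) E linear_free_map. Qed.

Lemma restr_nat (c d : C) (N : RMod A) (u : hom (d ⊗[V] A) (rmod N)) (g : hom c d) :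
  restr (N := N) (u ∘ (g ⊠[V] idm (alg A))) = restr (N := N) u ∘ g.
Proof.
rewrite /restr -!compA -runit_inv_nat; congr (_ ∘ _).
by rewrite !compA -!tensmD !comp1m !compm1.
Qed.

(** If [e : [A, y] ⊗ A → y] is the evaluation of the internal Hom of [C], then [[A, y]]
    carries the action dual to the left multiplication of [A], and is the cofree module
    on [y]. *)
Lemma forget_right_adjoint :
  has_right_adjoint (actR (regAction V) (alg A)) -> has_right_adjoint forget.
Proof.
move=> RA; apply: universal_right_adjoint => y.
have [r [e Ue]] := @has_right_adjoint_universal _ _ _ y RA.
have e_inj := universal_inj Ue.
(* [rho f b = (x ↦ f (b x))] in the notation of functions. *)
have [rho [/= Er _]] := Ue _ (e ∘ (idm r ⊠[V] amul A) ∘ assoc V r A A).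
have Er' x (g : hom x r) :
    e ∘ (rho ⊠[V] idm (alg A)) ∘ ((g ⊠[V] idm (alg A)) ⊠[V] idm (alg A))
    = e ∘ (g ⊠[V] idm (alg A)) ∘ (idm x ⊠[V] amul A) ∘ assoc V x A A.
  rewrite Er -!compA assoc_nat tensm1; congr (_ ∘ _); rewrite !compA; congr (_ ∘ _).
  by rewrite -!tensmD !comp1m !compm1.
have rA : rho ∘ (rho ⊠[V] idm (alg A)) = rho ∘ (idm r ⊠[V] amul A) ∘ assoc V r A A.
  apply: e_inj => /=; rewrite !tensm_compl !compA Er' !Er.
  rewrite -[idm (r ⊗[V] A)]tensm1 -!compA (compA (fwd (assoc V r A A))) assoc_nat.
  rewrite (compA (fwd (assoc V r A A))) assoc_nat -!compA pentagon.
  rewrite !compA; do 2 congr (_ ∘ _).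
  by rewrite -!compA -!tensm_compr amulA -compA.
have r1 : rho ∘ (idm r ⊠[V] aone A) = runit V r.
  apply: e_inj => /=; rewrite tensm_compl compA Er -!compA assoc_nat.
  by rewrite (compA (idm r ⊠[V] amul A)) -tensm_compr amul1l triangle.
pose R := Build_RMod rA r1.
(* The universal arrow evaluates at the unit of [A]. *)
pose u : hom r y := e ∘ (idm r ⊠[V] aone A) ∘ bwd (runit V r).
have u_rho : u ∘ rho = e.
  rewrite /u -!compA -runit_inv_nat (compA (idm r ⊠[V] _)) tensm_rl -tensm_lr !compA Er.
  rewrite -tensm1 -!compA (compA (fwd (assoc V r A A))) assoc_nat !compA -(compA e).
  rewrite -tensm_compr amul1r -(compA e) runit_assoc.
  by rewrite -compA fwdK compm1.
exists R, u => N f.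
have [g [/= Eg Ug]] := Ue _ (f ∘ ract N).
have g_lin : @rmod_linear C V A N R g.
  apply: e_inj; rewrite /= !tensm_compl !compA Eg Er'.
  rewrite Eg -!compA; congr (_ ∘ _); rewrite !compA; exact: ractA.
exists (exist _ g g_lin); split.
  rewrite /= /u -!compA -runit_inv_nat (compA (idm r ⊠[V] _)) tensm_rl -tensm_lr.
  by rewrite !compA Eg -(compA f) ract1 -compA fwdK compm1.
move=> [g' g'_lin] /= Eg'; apply: rmod_hom_inj => /=; apply: Ug.
by rewrite -Eg' -compA g'_lin compA u_rho.
Qed.
End Modules.

(** * Internal Homs out of the object corresponding to the algebra *)

Lemma is_epi_comp_faithful (C D : Cat) (F : Functor C D) (x y : C) (f : hom x y) :
  faithful F -> is_epi (fmap F f) -> is_epi f.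
Proof. by move=> Ff Ef z g h E; apply/Ff/Ef; rewrite -!fmapD E. Qed.

Section AlgebraObject.
Context {C : Cat} {V : Monoidal C} {M : Cat} {a : Action V M} {A : Algebra V}.
Context {F : Functor M (modCat A)} (S : LaxModStr a (modAct A) F).
Context (eqF : is_equivalence F) (S_strong : lax_strong S).
Context (iH : forall m : M, RightAdjoint (actR a m)).
Context (m : M) (phi : @Iso (modCat A) (F m) (regMod A)).

(** [Hom (c ▷ m, n) = Hom (F (c ▷ m), F n) = Hom (c ⊗ A, F n)]. *)
Definition free_transpose (c : C) (n : M) (f : hom (c ▷[a] m) n) :
    @hom (modCat A) (ma_act c (regMod A)) (F n) :=
  fmap F f ∘ lax S c m ∘ actm (modAct A) (idm c) (bwd phi).

(** Restriction along the unit of [A] then gives [Hom (c ▷ m, n) = Hom (c, F n)], so that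
    the underlying object of [F n] is another internal Hom from [m] to [n]. *)
Definition transpose (c : C) (n : M) (f : hom (c ▷[a] m) n) : hom c (rmod (F n)) :=
  restr (sval (free_transpose f)).

Lemma free_transposeD (c d : C) (n : M) (f : hom (d ▷[a] m) n) (g : hom c d) :
  free_transpose (f ∘ actm a g (idm m)) =
  free_transpose f ∘ actm (modAct A) g (idm (regMod A : modCat A)).
Proof.
rewrite /free_transpose fmapD -(compA (fmap F f)) -lax_nat fmap1 -!compA.
by rewrite -!actmD !comp1m !compm1.
Qed.

Lemma transposeD (c d : C) (n : M) (f : hom (d ▷[a] m) n) (g : hom c d) :
  transpose (f ∘ actm a g (idm m)) = transpose f ∘ g.
Proof. by rewrite /transpose free_transposeD; apply: restr_nat. Qed.

Lemma transpose_nat (c : C) (n n' : M) (f : hom (c ▷[a] m) n) (h : hom n n') :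
  transpose (h ∘ f) = sval (fmap F h) ∘ transpose f.
Proof.
by rewrite /transpose /free_transpose fmapD -(compA (fmap F h)) -!compA /restr /= !compA.
Qed.

Lemma free_transpose_iso (c : C) :
  exists i : @Iso (modCat A) (ma_act c (regMod A)) (F (c ▷[a] m)),
  forall n (f : hom (c ▷[a] m) n), free_transpose f = fmap F f ∘ i.
Proof.
have [j Ej] := is_iso_Iso (S_strong c m).
exists (iso_comp j (actIso (modAct A) (idIso c) (iso_inv phi))) => n f.
by rewrite /free_transpose -Ej -compA.
Qed.

Lemma transpose_inj (c : C) (n : M) : injective (@transpose c n).
Proof.
move=> f f' /restr_inj E; apply: (equivalence_faithful eqF).
have [i Ei] := free_transpose_iso c; apply: (iso_epic (i := i)); rewrite -!Ei.
by apply: rmod_hom_inj; apply: E; apply: svalP.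
Qed.

Lemma transpose_surj (c : C) (n : M) (h : hom c (rmod (F n))) :
  exists f : hom (c ▷[a] m) n, transpose f = h.
Proof.
have [i Ei] := free_transpose_iso c.
pose t : @hom (modCat A) (ma_act c (regMod A)) (F n) := exist _ _ (free_map_linear h).
have [f Ef] := equivalence_full eqF (t ∘ bwd i).
exists f; rewrite /transpose Ei Ef -compA bwdK compm1; exact: restr_free_map.
Qed.

Definition hom_to_forget (n : M) : hom (ihom iH m n) (rmod (F n)) := transpose (iev iH m n).

Lemma transpose_ibr (c : C) (n : M) (u : hom c (ihom iH m n)) :
  transpose (ibr u) = hom_to_forget n ∘ u.
Proof. exact: transposeD. Qed.

Lemma hom_to_forget_iso (n : M) : is_iso (hom_to_forget n).
Proof.
have [f Ef] := transpose_surj (idm (rmod (F n))).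
have fK : hom_to_forget n ∘ ilift iH f = idm _ by rewrite -transpose_ibr ibr_lift.
exists (ilift iH f); split=> //.
apply/(@ibr_inj _ _ _ _ iH)/transpose_inj.
by rewrite !transpose_ibr compA fK comp1m compm1.
Qed.

Lemma hom_to_forget_nat (n n' : M) (f : hom n n') :
  hom_to_forget n' ∘ fmap (ihomF iH m) f = sval (fmap F f) ∘ hom_to_forget n.
Proof.
rewrite -transpose_ibr -[fmap (ihomF iH m) f]compm1 ibr_map ibr_id.
exact: transpose_nat.
Qed.

(** The lax structure on [Hom(m, -)] is the one that the forgetful functor of [mod-A]
    inherits from [F]: both are determined by how they act on the evaluation. *)
Lemma hom_to_forget_lax (c : C) (n : M) :
  hom_to_forget (c ▷[a] n) ∘ ilax iH m c n =
  sval (lax S c n) ∘ (idm c ⊠[V] hom_to_forget n).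
Proof.
rewrite -transpose_ibr ibr_ilax1 /transpose /hom_to_forget.
set x := ihom iH m n.
have -> : free_transpose (actm a (idm c) (iev iH m n) ∘ aassoc a c x m) =
    lax S c n ∘ actm (modAct A) (idm c) (free_transpose (iev iH m n))
      ∘ aassoc (modAct A) c x (regMod A : modCat A).
  rewrite /free_transpose fmapD -!compA (compA (fmap F (aassoc a c x m))) lax_assoc.
  rewrite !actF_D !compA -lax_nat -!compA.
  by rewrite -(aassoc_nat (modAct A)) (tensm1 V).
rewrite /restr /= !tensm_compr -!compA; do 4 congr (_ ∘ _).
rewrite compA -[idm (c ⊗[V] x)]tensm1 assoc_nat -compA; congr (_ ∘ _).
apply: (iso_epic (i := runit V (c ⊗[V] x))); rewrite -compA bwdK compm1.
by rewrite -runit_assoc compA -tensm_compr bwdK tensm1 comp1m.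
Qed.

Lemma ihom_lax_strong : lax_strong (ihom_lax iH m).
Proof.
move=> c n; have [i Ei] := is_iso_Iso (hom_to_forget_iso (c ▷[a] n)).
have [j Ej] := is_iso_Iso (hom_to_forget_iso n).
have [l [lK Kl]] := S_strong c n.
have sl : is_iso (sval (lax S c n)).
  by exists (sval l); split; [have := congr1 sval lK | have := congr1 sval Kl].
have := hom_to_forget_lax c n; rewrite -Ei -Ej => E.
have -> : lax (ihom_lax iH m) c n = bwd i ∘ (sval (lax S c n) ∘ (idm c ⊠[V] j)).
  by rewrite -E compA bwdK comp1m.
apply: is_iso_comp; first exact: (iso_is_iso (iso_inv i)).
by apply: is_iso_comp => //; apply: (iso_is_iso (tensIso V (idIso c) j)).
Qed.

Lemma ihom_right_adjoint :
  has_right_adjoint (actR (regAction V) (alg A)) -> has_right_adjoint (ihomF iH m).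
Proof.
move=> RA.
have [e He] : exists e : forall n, Iso (ihom iH m n) (rmod (F n)),
    forall n, fwd (e n) = hom_to_forget n.
  have ex n : {i : Iso (ihom iH m n) (rmod (F n)) | fwd i = hom_to_forget n}.
    exact: constructive_indefinite_description (is_iso_Iso (hom_to_forget_iso n)).
  by exists (fun n => sval (ex n)) => n; exact: (svalP (ex n)).
have e_nat n n' (f : hom n n') :
    iso_inv (e n') ∘ fmap (compF (forget A) F) f = fmap (ihomF iH m) f ∘ iso_inv (e n).
  by apply: iso_sq; rewrite !He; apply: hom_to_forget_nat.
apply: (has_right_adjoint_natiso
  (@Build_NatIso _ _ (compF (forget A) F) (ihomF iH m) (fun n => iso_inv (e n)) e_nat)).
apply: has_right_adjoint_comp; first exact: forget_right_adjoint.
exact: equivalence_right_adjoint.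
Qed.

(** The evaluation at [n] is epi because [Hom(m, -)], being isomorphic to the composite of
    [F] with the forgetful functor, is faithful. *)
Lemma iev_epi (n : M) : is_epi (iev iH m n).
Proof.
move=> p f g E; apply: (equivalence_faithful eqF); apply: rmod_hom_inj.
have [i Ei] := is_iso_Iso (hom_to_forget_iso n).
apply: (iso_epic (i := i)); rewrite Ei -!hom_to_forget_nat.
by congr (_ ∘ _); apply: (@ibr_inj _ _ _ _ iH);
  rewrite -[fmap _ f]compm1 -[fmap _ g]compm1 !ibr_map ibr_id.
Qed.

Lemma algebra_object_in_hat :
  has_right_adjoint (actR (regAction V) (alg A)) ->
  in_hat_tens iH m /\ is_generator a m.
Proof.
move=> RA; split; first by split; [apply: ihom_lax_strong | apply: ihom_right_adjoint].
by move=> n; exists (ihom iH m n), (iev iH m n); apply: iev_epi.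
Qed.
End AlgebraObject.

(** * Coequalizers and balanced categories *)

Definition is_coequalizer (C : Cat) (x y q : C) (f g : hom x y) (p : hom y q) : Prop :=
  p ∘ f = p ∘ g /\
  forall z (h : hom y z), h ∘ f = h ∘ g -> exists! t : hom q z, t ∘ p = h.

Definition has_coequalizers (C : Cat) : Prop :=
  forall (x y : C) (f g : hom x y), exists q (p : hom y q), is_coequalizer f g p.

Definition balanced (C : Cat) : Prop :=
  forall (x y : C) (f : hom x y), is_mono f -> is_epi f -> is_iso f.

Lemma coequalizer_epi (C : Cat) (x y q : C) (f g : hom x y) (p : hom y q) :
  is_coequalizer f g p -> is_epi p.
Proof.
move=> [E U] z h h' Eh.
have [|t [_ Ut]] := U z (h' ∘ p); first by rewrite -!compA E.
by rewrite -(Ut h Eh) (Ut h').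
Qed.

Lemma zero_mor_compl (C : Cat) (x y z : C) (g : hom y z) (f : hom x y) :
  zero_mor f -> zero_mor (g ∘ f).
Proof. by case=> o [i [j [Ho ->]]]; exists o, (g ∘ i), j; rewrite compA. Qed.

Lemma zero_mor_uniq (C : Cat) (x y : C) (f g : hom x y) :
  zero_mor f -> zero_mor g -> f = g.
Proof.
case=> o [i [j [[oi ot] ->]]] [o' [i' [j' [[oi' ot'] ->]]]].
have [k _] := oi o'.
have [i0 [_ Ui]] := oi y; have [j0 [_ Uj]] := ot' x.
by rewrite -(Uj j' I) (Uj (k ∘ j) I) compA -(Ui (i' ∘ k) I) (Ui i I).
Qed.

Section AbelianFacts.
Context {C : Cat} (abC : is_abelian C).

Lemma abelian_zero_mor (x y : C) : exists f : hom x y, zero_mor f.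
Proof.
have [o [oi ot]] := ab_zero abC.
by have [i _] := oi y; have [j _] := ot x; exists (i ∘ j), o, i, j.
Qed.

(** A split epimorphism [[f, 1] : x ⊔ y → y] is the cokernel of some [u]. A morphism [h]
    out of [y] satisfies [h ∘ f = h ∘ g] exactly when [h ∘ [g, 1]] factors through
    [[f, 1]], that is, when it kills [u]; so the cokernel of [[g, 1] ∘ u] coequalizes
    [f] and [g], and no addition of morphisms has to be constructed. *)
Lemma abelian_coequalizers : has_coequalizers C.
Proof.
move=> x y f g; have [s [i1 [i2 Us]]] := ab_coprod abC x y.
have cop_ext z (h h' : hom s z) : h ∘ i1 = h' ∘ i1 -> h ∘ i2 = h' ∘ i2 -> h = h'.
  move=> E1 E2; have [t [_ Ut]] := Us z (h' ∘ i1) (h' ∘ i2).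
  by rewrite -(Ut h) // (Ut h').
have [pf [[pf1 pf2] _]] := Us y f (idm y).
have [pg [[pg1 pg2] _]] := Us y g (idm y).
have epf : is_epi pf.
  by move=> z h h' E; rewrite -[h]compm1 -[h']compm1 -pf2 !compA E.
have [w [u [zu Uu]]] := ab_epi abC epf.
have [q [p [zp Up]]] := ab_coker abC (pg ∘ u).
have fact z (h : hom y z) : h ∘ f = h ∘ g <-> zero_mor (h ∘ (pg ∘ u)).
  split=> [E | ].
    have -> : h ∘ (pg ∘ u) = h ∘ pf ∘ u.
      rewrite compA; congr (_ ∘ _).
      by apply: cop_ext; rewrite -!compA ?pf1 ?pg1 ?pf2 ?pg2.
    by rewrite -compA; apply: zero_mor_compl.
  rewrite compA => /Uu[k [Ek _]].
  have Ehk : k = h by rewrite -[k]compm1 -pf2 compA Ek -compA pg2 compm1.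
  by rewrite -pf1 compA -Ehk Ek Ehk -compA pg1.
exists q, p; split; first exact/fact.
by move=> z h /fact /Up.
Qed.

(** An epimorphism is the cokernel of some [u]; if it is also mono, then [u] is zero. *)
Lemma abelian_balanced : balanced C.
Proof.
move=> x y f Mf Ef; have [w [u [zu Uu]]] := ab_epi abC Ef.
have [o zo] := abelian_zero_mor w x.
have Eu : u = o by apply: Mf; apply: zero_mor_uniq => //; apply: zero_mor_compl.
have [|h [Eh _]] := Uu x (idm x); first by rewrite comp1m Eu.
by exists h; split=> //; apply: Ef; rewrite -compA Eh compm1 comp1m.
Qed.
End AbelianFacts.

Section TransportAlongEquivalence.
Context {C D : Cat} {F : Functor C D} (E : is_equivalence F).

Local Notation Ff := (equivalence_faithful E).

Lemma equivalence_is_mono (x y : C) (f : hom x y) : is_mono f -> is_mono (fmap F f).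
Proof.
move=> Mf d g h; have [c [i]] := equivalence_ess_surj E d.
have [g' Eg] := equivalence_full E (g ∘ i); have [h' Eh] := equivalence_full E (h ∘ i).
move=> Egh; apply: (iso_epic (i := i)); rewrite -Eg -Eh; congr fmap; apply/Mf/Ff.
by rewrite !fmapD Eg Eh !compA Egh.
Qed.

Lemma equivalence_is_epi (x y : C) (f : hom x y) : is_epi f -> is_epi (fmap F f).
Proof.
move=> Mf d g h; have [c [i]] := equivalence_ess_surj E d.
have [g' Eg] := equivalence_full E (bwd i ∘ g).
have [h' Eh] := equivalence_full E (bwd i ∘ h).
move=> Egh; apply: (iso_monic (i := iso_inv i)); rewrite /= -Eg -Eh; congr fmap.
by apply/Mf/Ff; rewrite !fmapD Eg Eh -!compA Egh.
Qed.

Lemma equivalence_balanced : balanced D -> balanced C.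
Proof.
move=> bD x y f Mf Ef; apply: (ff_is_iso Ff (equivalence_full E)).
by apply: bD; [apply: equivalence_is_mono | apply: equivalence_is_epi].
Qed.

Lemma equivalence_coequalizers : has_coequalizers D -> has_coequalizers C.
Proof.
move=> cD x y f g; have [d [p [Ep Up]]] := cD _ _ (fmap F f) (fmap F g).
have [q [i]] := equivalence_ess_surj E d.
have [p' Ep'] := equivalence_full E (bwd i ∘ p).
exists q, p'; split; first by apply: Ff; rewrite !fmapD Ep' -!compA Ep.
move=> z h Eh; have [|t [Et Ut]] := Up _ (fmap F h); first by rewrite -!fmapD Eh.
have [t' Et'] := equivalence_full E (t ∘ i).
exists t'; split.
  by apply: Ff; rewrite fmapD Et' Ep' -compA (compA (fwd i)) fwdK comp1m.
move=> s Es; apply: Ff; rewrite Et' (Ut (fmap F s ∘ bwd i)) -?compA ?bwdK ?compm1 //.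
by rewrite -Ep' -fmapD Es.
Qed.
End TransportAlongEquivalence.

(** * Monadicity of the comparison functor *)

Section Monadicity.
Context {C : Cat} {V : Monoidal C} {M : Cat} {a : Action V M}.
Context (iH : forall m : M, RightAdjoint (actR a m)).
Context (coeqM : has_coequalizers M) (balM : balanced M).
Context (m : M) (m_hat : in_hat_tens iH m) (m_gen : is_generator a m).

Local Notation A := (iEnd iH m).
Local Notation H := (ihomF iH m).

Lemma ihom_faithful : faithful H.
Proof.
move=> n p f g E; have [c [e Ee]] := m_gen n; apply: Ee.
by rewrite -(ibr_lift iH e) -!ibr_map E.
Qed.

(** [H] is faithful, hence reflects monomorphisms and epimorphisms. *)
Lemma ihom_conservative (n p : M) (f : hom n p) : is_iso (fmap H f) -> is_iso f.
Proof.
case/is_iso_Iso=> i Ei; apply: balM.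
  move=> z g h E; apply/ihom_faithful/(iso_monic (i := i)).
  by rewrite Ei -!fmapD E.
by apply: (is_epi_comp_faithful ihom_faithful); rewrite -Ei => z g h /iso_epic.
Qed.

(** [H] preserves coequalizers, being a left adjoint. *)
Lemma ihom_coequalizer (x y q : M) (f g : hom x y) (p : hom y q) :
  is_coequalizer f g p -> is_coequalizer (fmap H f) (fmap H g) (fmap H p).
Proof.
move=> Cp; have [Ep Up] := Cp; have [R] := m_hat.2.
split; first by rewrite -!fmapD Ep.
move=> z h Eh; have [|t [Et Ut]] := Up _ (lift R h).
  by apply: (lift_inj (R := R)); rewrite !fmapD !compA !counit_lift.
exists (counit R z ∘ fmap H t); split; first by rewrite -compA -fmapD Et counit_lift.
move=> s Es; rewrite -(counit_lift R s); congr (_ ∘ fmap H _); apply: Ut.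
by apply: (lift_inj (R := R)); rewrite fmapD compA !counit_lift.
Qed.

(** The two actions on [X ▷ m] of the monad [- ⊗ Hom(m, m)]: through the module [X], and
    by evaluation. *)
Definition bar_act (X : RMod A) : hom ((rmod X ⊗[V] A) ▷[a] m) (rmod X ▷[a] m) :=
  actm a (ract X) (idm m).

Definition bar_ev (X : RMod A) : hom ((rmod X ⊗[V] A) ▷[a] m) (rmod X ▷[a] m) :=
  actm a (idm (rmod X)) (iev iH m m) ∘ aassoc a (rmod X) A m.

Lemma ilax_bar_act (X : RMod A) :
  fmap H (bar_act X) ∘ ilax iH m (rmod X ⊗[V] A) m =
  ilax iH m (rmod X) m ∘ (ract X ⊠[V] idm (alg A)).
Proof. by rewrite -[bar_act X]/(actm a _ _) -ilax_nat fmap1. Qed.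

Lemma ilax_bar_ev (X : RMod A) :
  fmap H (bar_ev X) ∘ ilax iH m (rmod X ⊗[V] A) m =
  ilax iH m (rmod X) m ∘ (idm (rmod X) ⊠[V] amul A) ∘ assoc V (rmod X) A A.
Proof.
apply: (@ibr_inj _ _ _ _ iH); rewrite ibr_map ibr_ilax1 ibr_nat ibr_ilax /= ibr_icomp.
rewrite /bar_ev -[idm (rmod X ⊗[V] A)]tensm1 -!compA.
rewrite (compA (fwd (aassoc a (rmod X) A m))) aassoc_nat -compA apentagon.
by rewrite !actF_D !compA.
Qed.

(** Since [Hom(m, -)] is strong, it turns [bar_act] and [bar_ev] into the pair
    [X ⊗ A ⊗ A ⇉ X ⊗ A], of which the action [X ⊗ A → X] is a split coequalizer. As
    [Hom(m, -)] preserves the coequalizer [Q], it sends [Q] to [X]. *)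
Lemma bar_coequalizer (X : RMod A) (Q : M) (p : hom (rmod X ▷[a] m) Q) :
  is_coequalizer (bar_act X) (bar_ev X) p -> is_iso (ilift iH p).
Proof.
move=> Cp; set eta := ilift iH p.
have [lam Elam] := is_iso_Iso (m_hat.1 (rmod X) m).
have [lam' Elam'] := is_iso_Iso (m_hat.1 (rmod X ⊗[V] A) m).
rewrite /= in Elam Elam'.
(* [p] coequalizes: on transposes, this is the compatibility of [eta] with the action. *)
have eta_act : eta ∘ ract X = fmap H p ∘ lam.
  apply: (@ibr_inj _ _ _ _ iH); rewrite ibr_map Elam ibr_ilax1 ibr_nat ibr_lift.
  exact: Cp.1.
have eta_unit :
    fmap H p ∘ lam ∘ (idm (rmod X) ⊠[V] aone A) ∘ bwd (runit V (rmod X)) = eta.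
  by rewrite -eta_act -!compA (compA (ract X)) ract1 fwdK compm1.
have [|th [Eth _]] := (ihom_coequalizer Cp).2 _ (ract X ∘ bwd lam).
  apply: (iso_epic (i := lam')); rewrite -!compA Elam' ilax_bar_act ilax_bar_ev -Elam.
  by rewrite -!compA !(compA (bwd lam)) bwdK !comp1m ractA compA.
exists th; split.
  rewrite -eta_unit !compA Eth -(compA (ract X)) bwdK compm1 ract1.
  exact: fwdK.
apply: (coequalizer_epi (ihom_coequalizer Cp)); apply: (iso_epic (i := lam)).
by rewrite comp1m -eta_act -(compA eta) Eth !compA -(compA _ (bwd lam)) bwdK compm1.
Qed.

Lemma iev_bar (n : M) :
  iev iH m n ∘ bar_act (cmp_ob iH m n) = iev iH m n ∘ bar_ev (cmp_ob iH m n).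
Proof. by rewrite -[LHS]/(ibr (icomp iH m m n)) ibr_icomp /bar_ev compA. Qed.

(** A linear map [g : Hom(m, n) → Hom(m, n')] transposes to a morphism out of
    [Hom(m, n) ▷ m] that coequalizes the two actions, and descends to [n]: by
    [bar_coequalizer] and conservativity, the evaluation is their coequalizer. *)
Lemma comparison_full : full (comparison iH m).
Proof.
move=> n n' g; have [Q [p Cp]] := coeqM (bar_act (cmp_ob iH m n)) (bar_ev (cmp_ob iH m n)).
have [t [Et _]] := Cp.2 _ _ (iev_bar n).
have : is_iso t.
  apply: ihom_conservative; have [i Ei] := is_iso_Iso (bar_coequalizer Cp).
  have E : fmap H t ∘ i = idm _.
    by apply: (@ibr_inj _ _ _ _ iH); rewrite ibr_map Ei ibr_lift ibr_id.
  have -> : fmap H t = bwd i by rewrite -[RHS]comp1m -E -compA fwdK compm1.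
  exact: iso_is_iso (iso_inv i).
case/is_iso_Iso=> j Ej.
have [|f0 [Ef0 _]] := Cp.2 _ (ibr (sval g)).
  rewrite -ibr_nat [sval g ∘ _](svalP g) /= ibr_comp ibr_id.
  by rewrite /bar_ev compA.
exists (f0 ∘ bwd j); apply: rmod_hom_inj; apply: (@ibr_inj _ _ _ _ iH).
rewrite -[sval _]compm1 ibr_map ibr_id.
by rewrite -Et -Ej -compA (compA (bwd j)) bwdK comp1m.
Qed.

Lemma comparison_equivalence : is_equivalence (comparison iH m).
Proof.
apply: ff_eso_equivalence.
- by move=> n n' f g /(congr1 sval); apply: ihom_faithful.
- exact: comparison_full.
move=> X; have [Q [p Cp]] := coeqM (bar_act X) (bar_ev X).
have [i Ei] := is_iso_Iso (bar_coequalizer Cp).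
have lin : @rmod_linear C V A X (cmp_ob iH m Q) i.
  rewrite /rmod_linear /=; apply: (@ibr_inj _ _ _ _ iH).
  rewrite ibr_comp ibr_id ibr_nat Ei ibr_lift -compA.
  exact: Cp.1.
exists Q; constructor; exact: (iso_inv (rmodIso lin)).
Qed.

(** The lax structure of the comparison functor is that of [Hom(m, -)], and a linear map
    which is invertible in [C] is invertible in [mod-A]. *)
Lemma comparison_module_equivalence : is_module_equivalence (comparison_lax iH m).
Proof.
split; first exact: comparison_equivalence.
move=> c n; have [i Ei] := is_iso_Iso (m_hat.1 c n); rewrite /= in Ei.
have lin : @rmod_linear C V A (ma_act c (cmp_ob iH m n)) (cmp_ob iH m (c ▷[a] n)) i.
  by rewrite Ei; apply: cmp_lax_linear.
have -> : lax (comparison_lax iH m) c n = rmodIso lin by apply: rmod_hom_inj; rewrite /= Ei.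
exact: iso_is_iso.
Qed.
End Monadicity.

(** * Invariance of GV-module categories *)

Section GVTransport.
Context {C : Cat} {V : Monoidal C} {M N : Cat} {a : Action V M} {b : Action V N}.
Context {F : Functor M N} (S : LaxModStr a b F).

(** Through a strong module equivalence [F] with quasi-inverse [Q], the functor [c ▷ -] of
    [N] is [F (c ▷ Q -)], and [- ▷ n] is [F (- ▷ Q n)]. *)
Lemma module_equivalence_GV :
  is_module_equivalence S -> is_GV_module a -> is_GV_module b.
Proof.
move=> [eF Ss] [RF RR]; have [E] := eF.
have Li c m : {i : Iso (c ▷[b] F m) (F (c ▷[a] m)) | fwd i = lax S c m}.
  exact: constructive_indefinite_description (is_iso_Iso (Ss c m)).
pose l c m := sval (Li c m); have lE c m : fwd (l c m) = lax S c m := svalP (Li c m).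
pose e := ecounit E.
have l_nat c c' n n' (f : hom c c') (g : hom n n') :
    bwd (l c' n') ∘ fmap F (actm a f g) = actm b f (fmap F g) ∘ bwd (l c n).
  by apply: iso_sq; rewrite !lE lax_nat.
split=> [c | n].
  pose j n : Iso (compF F (compF (actF a c) (qinv E)) n) (actF b c n) :=
    iso_comp (actIso b (idIso c) (e n)) (iso_inv (l c (qinv E n))).
  have j_nat n n' (f : hom n n') :
      j n' ∘ fmap (compF F (compF (actF a c) (qinv E))) f = fmap (actF b c) f ∘ j n.
    rewrite /= -compA l_nat !compA; congr (_ ∘ _).
    by rewrite -!actF_D; congr (actm _ _ _); apply: (nnat e).
  apply: (has_right_adjoint_natiso (Build_NatIso j_nat)).
  apply: has_right_adjoint_comp; first exact: equivalence_right_adjoint.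
  apply: has_right_adjoint_comp; first exact: RF.
  exact/equivalence_right_adjoint/qinv_equivalence.
pose j c : Iso (compF F (actR a (qinv E n)) c) (actR b n c) :=
  iso_comp (actIso b (idIso c) (e n)) (iso_inv (l c (qinv E n))).
have j_nat c c' (f : hom c c') :
    j c' ∘ fmap (compF F (actR a (qinv E n))) f = fmap (actR b n) f ∘ j c.
  rewrite /= -compA l_nat !compA; congr (_ ∘ _).
  by rewrite fmap1 actm_rl actm_lr.
apply: (has_right_adjoint_natiso (Build_NatIso j_nat)).
apply: has_right_adjoint_comp; first exact: equivalence_right_adjoint.
exact: RR.
Qed.
End GVTransport.

(** * Zero objects *)

(** If [m] is a zero object, then [c ▷ m] is initial since [c ▷ -] preserves colimits, so
    that every [x] is the target of an epimorphism out of an initial object; parallel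
    morphisms out of [x] are then equal, and [x] is a retract of [m]. *)
Lemma zero_generator (C : Cat) (V : Monoidal C) (M : Cat) (a : Action V M) (m : M) :
  (forall c : C, has_right_adjoint (actF a c)) ->
  is_generator a m -> is_zero m -> forall x : M, is_zero x.
Proof.
move=> RF gen [mi mt] x; have [c [p Ep]] := gen x; have [R] := RF c.
have x_uniq y (f g : hom x y) : f = g.
  apply: Ep; have [k [_ Uk]] := mi (R y).
  rewrite -(@counit_lift _ _ _ R m y (f ∘ p)) -(@counit_lift _ _ _ R m y (g ∘ p)).
  by rewrite -(Uk (lift R (f ∘ p)) I) (Uk (lift R (g ∘ p)) I).
have [s _] := mi x; have [r _] := mt x.
split=> y.
  have [k _] := mi y; exists (k ∘ r); split=> // f _; exact: x_uniq.
have [k _] := mt y; exists (s ∘ k); split=> // f _.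
rewrite -[f]comp1m (x_uniq _ (idm x) (s ∘ r)) -compA; congr (_ ∘ _).
by have [t [_ Ut]] := mt y; rewrite -(Ut k I) (Ut (r ∘ f) I).
Qed.

(** * Closedness of GV-categories *)

Section Closed.
Context (C : GVCat).

Local Notation V := (gv_mon C).
Local Notation G := (dGF (gv_dual C)).
Local Notation E := (gv_inv C).
Local Notation GD := (gv_dual C).

(** With [z = G w], [Hom (x ⊗ y, z) = Hom (x ⊗ y ⊗ w, K) = Hom (x, G (y ⊗ w))]. *)
Lemma tens_left_closed (y : C) : has_right_adjoint (actR (regAction V) y).
Proof.
apply: universal_right_adjoint => z; set w := qinv E z : ob C.
have e : Iso (gvG w) z := ecounit E z.
apply: (has_universal_transfer (F := actR (regAction V) y) (d := z)
  (F' := actR (regAction V) (y ⊗[V] w)) (d' := dK GD)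
  (t := fun x h => e ∘ dlift GD (h ∘ assoc V x y w))).
- move=> x x' g h; rewrite -[RHS]compA; congr (_ ∘ _); apply: dlift_inj.
  rewrite dev_lift tensm_compl compA dev_lift /= -!compA; congr (_ ∘ _).
  by rewrite assoc_nat tensm1.
- move=> x h h' /iso_monic /(congr1 (fun u => dev GD w ∘ (u ⊠[V] idm w))).
  by rewrite !dev_lift => /iso_epic.
- move=> x f; exists (dev GD w ∘ ((bwd e ∘ f) ⊠[V] idm w) ∘ bwd (assoc V x y w)).
  by rewrite -!compA bwdK compm1 dlift_dev compA fwdK comp1m.
- exists (gvG (y ⊗[V] w)), (dev GD (y ⊗[V] w)) => x f.
  by exists (dlift GD f); split; [apply: dev_lift | move=> g <-; apply: dlift_dev].
Qed.

(** With [z = G w], maps [G v ⊗ x → z] amount to maps [G v ⊗ (x ⊗ w) → K], that is,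
    [G v → G (x ⊗ w)], that is, [x ⊗ w → v]. *)
Lemma tens_right_closed (v : C) : has_right_adjoint (actF (regAction V) (gvG v)).
Proof.
apply: universal_right_adjoint => z; set w := qinv E z : ob C.
have e : Iso (gvG w) z := ecounit E z.
apply: (has_universal_transfer (F := actF (regAction V) (gvG v)) (d := z)
  (F' := actR (regAction V) w) (d' := v)
  (t := fun x h => e ∘ dlift GD (dev GD (x ⊗[V] w) ∘ (dG_map GD h ⊠[V] idm (x ⊗[V] w))
                                ∘ assoc V (gvG v) x w))).
- move=> x x' g h; rewrite -[RHS]compA; congr (_ ∘ _); apply: dlift_inj.
  rewrite dev_lift tensm_compl !compA !dev_map dev_lift /=.
  rewrite -!compA assoc_nat !compA; congr (_ ∘ _).
  by rewrite -compA -tensmD comp1m.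
- move=> x h h' /iso_monic /(congr1 (fun u => dev GD w ∘ (u ⊠[V] idm w))).
  rewrite !dev_lift => /iso_epic; rewrite -!dev_map => /dlift_inj.
  exact: (equiv_faithful E).
- move=> x f.
  pose u := dev GD w ∘ ((bwd e ∘ f) ⊠[V] idm w) ∘ bwd (assoc V (gvG v) x w).
  pose h : hom (x ⊗[V] w) v := @preim (opCat C) C G E v (x ⊗[V] w) (dlift GD u).
  exists h; have -> : dG_map GD h = dlift GD u by apply: (@preimK (opCat C) C G E).
  by rewrite dev_lift /u -!compA bwdK compm1 dlift_dev compA fwdK comp1m.
- exact/has_right_adjoint_universal/tens_left_closed.
Qed.

(** On [C^op], the functor [- ⊙ c] is the composite of [G], [G c ⊗ -] and the
    quasi-inverse of [G]. *)
Lemma odot_closed (c : C) :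
  has_right_adjoint (actR (regAction (opMon (odot C))) (c : opCat C)).
Proof.
pose T := compF (qinv E) (compF (actF (regAction V) (gvG c)) G).
have nat (x y : opCat C) (f : hom x y) :
    idIso _ ∘ fmap T f = fmap (actR (regAction (opMon (odot C))) (c : opCat C)) f ∘ idIso (T x).
  rewrite compm1 comp1m /= /tr_tensm; congr (fmap (qinv E) (_ ⊠[V] _)).
  by apply: esym; apply: (fmap1 G).
apply: (has_right_adjoint_natiso
  (@Build_NatIso _ _ T (actR (regAction (opMon (odot C))) (c : opCat C))
    (fun x => idIso (T x)) nat)).
have eG : is_equivalence G by constructor; apply: E.
apply: has_right_adjoint_comp.
  exact/equivalence_right_adjoint/qinv_equivalence.
apply: has_right_adjoint_comp; last exact: equivalence_right_adjoint.
exact: tens_right_closed.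
Qed.
End Closed.

(** * Finite-dimensional modules over an algebra *)

Section FiniteDimensionalModules.
Local Open Scope ring_scope.
Import GRing.Theory.
Context {k : fieldType} {A : FDAlgebra k}.

Lemma fact0 (V : FDModule A) (b : A) : fact b (0 : V) = 0.
Proof. by have := fact_linr (-1) b (0 : V) 0; rewrite scaleN1r addNr scaleN1r addNr. Qed.

Lemma factB (V : FDModule A) (b : A) (v w : V) : fact b (v - w) = fact b v - fact b w.
Proof. by have := fact_linr (-1) b w v; rewrite !scaleN1r ![- _ + _]addrC. Qed.

Definition stable (V : FDModule A) (U : {vspace V}) : Prop :=
  forall (b : A) v, v \in U -> fact b v \in U.

Section SubQuotient.
Context (V : FDModule A) (U : {vspace V}) (sU : stable U).

Definition sub_act (b : A) (u : subvs_of U) : subvs_of U := vsproj U (fact b (vsval u)).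

Lemma vsval_sub_act b u : vsval (sub_act b u) = fact b (vsval u).
Proof. by rewrite vsprojK // sU // subvsP. Qed.

Definition subMod : FDModule A.
Proof.
refine (@Build_FDModule k A (subvs_of U) sub_act _ _ _ _).
- by move=> b c u; apply: subvs_inj; rewrite !vsval_sub_act factA.
- by move=> u; apply: subvs_inj; rewrite vsval_sub_act fact1.
- by move=> c b b' u; apply: subvs_inj; rewrite linearP /= !vsval_sub_act fact_linl.
- by move=> c b u u'; apply: subvs_inj; rewrite linearP /= !vsval_sub_act linearP fact_linr.
Defined.

Lemma sub_incl_equivariant : @fd_equivariant k A subMod V (linfun vsval).
Proof. by move=> b u; rewrite !lfunE /=; apply: vsval_sub_act. Qed.

Definition sub_incl : fd_hom subMod V := exist _ _ sub_incl_equivariant.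

(** The quotient of [V] by [U] lives on a linear complement of [U], with the action
    followed by the projection along [U]. *)
Definition along : 'End(V) := daddv_pi (U^C) U.

Lemma along_sub v : v - along v \in U.
Proof.
have {1}<- : daddv_pi U (U^C) v + along v = v.
  by rewrite daddv_pi_add ?capv_compl // addv_complf memvf.
by rewrite addrK memv_pi.
Qed.

Lemma along_ker v : v \in U -> along v = 0.
Proof.
move=> Uv; have : daddv_pi U (U^C) v + along v = v.
  by rewrite daddv_pi_add ?capv_compl // addv_complf memvf.
by rewrite daddv_pi_id ?capv_compl // => /(canRL (addKr _)) ->; rewrite addNr.
Qed.

Lemma along_id v : v \in (U^C)%VS -> along v = v.
Proof. by apply: daddv_pi_id; rewrite capvC capv_compl. Qed.

(** The projection is not equivariant, but the error made by applying it before acting lies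
    in the submodule [U]. *)
Lemma along_act b v : along (fact b (along v)) = along (fact b v).
Proof.
have : along (fact b (v - along v)) = 0 by apply/along_ker/sU/along_sub.
by rewrite factB linearB => /subr0_eq.
Qed.

Definition quot_act (b : A) (u : subvs_of (U^C)) : subvs_of (U^C) :=
  vsproj (U^C) (along (fact b (vsval u))).

Lemma vsval_quot_act b u : vsval (quot_act b u) = along (fact b (vsval u)).
Proof. by rewrite vsprojK // memv_pi. Qed.

Definition quotMod : FDModule A.
Proof.
refine (@Build_FDModule k A (subvs_of (U^C)) quot_act _ _ _ _).
- by move=> b c u; apply: subvs_inj; rewrite !vsval_quot_act along_act factA.
- by move=> u; apply: subvs_inj; rewrite vsval_quot_act fact1 along_id ?subvsP.
- move=> c b b' u; apply: subvs_inj.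
  by rewrite linearP /= !vsval_quot_act fact_linl linearP.
- move=> c b u u'; apply: subvs_inj.
  by rewrite linearP /= !vsval_quot_act linearP fact_linr linearP.
Defined.

Definition quot_map : 'Hom(V, quotMod) := (linfun (vsproj (U^C)) \o along)%VF.

Lemma vsval_quot_map v : vsval (quot_map v) = along v.
Proof. by rewrite comp_lfunE lfunE /= vsprojK // memv_pi. Qed.

Lemma quot_map_equivariant : @fd_equivariant k A V quotMod quot_map.
Proof.
move=> b v; apply: subvs_inj; rewrite vsval_quot_map [RHS]vsval_quot_act.
by rewrite vsval_quot_map along_act.
Qed.

Definition quot_proj : fd_hom V quotMod := exist _ _ quot_map_equivariant.

Lemma quot_map_ker v : v \in U -> quot_map v = 0.
Proof. by move=> Uv; apply: subvs_inj; rewrite vsval_quot_map along_ker. Qed.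
End SubQuotient.

Lemma lker_stable (V W : FDModule A) (f : 'Hom(V, W)) : fd_equivariant f -> stable (lker f).
Proof. by move=> Ef b v; rewrite !memv_ker Ef => /eqP->; rewrite fact0. Qed.

Lemma limg_stable (V W : FDModule A) (f : 'Hom(V, W)) : fd_equivariant f -> stable (limg f).
Proof.
by move=> Ef b _ /memv_imgP[v _ ->]; rewrite -Ef; apply/memv_img/memvf.
Qed.

Lemma sub_equivariant (V W : FDModule A) (f g : fd_hom V W) :
  fd_equivariant (sval f - sval g).
Proof.
by move=> b v; rewrite !add_lfunE !opp_lfunE (svalP f) (svalP g) factB.
Qed.

Lemma zero_equivariant (V W : FDModule A) : fd_equivariant (0 : 'Hom(V, W)).
Proof. by move=> b v; rewrite !zero_lfunE fact0. Qed.

Definition fd_zero (V W : FDModule A) : fd_hom V W := exist _ _ (@zero_equivariant V W).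

Lemma fd_coequalizers : has_coequalizers (fdModCat A).
Proof.
move=> V W f g; have sU := limg_stable (sub_equivariant f g).
exists (quotMod sU), (quot_proj sU); split.
  apply: fd_hom_inj; apply/lfunP=> v; rewrite /= comp_lfunE [RHS]comp_lfunE.
  have : quot_map sU (sval f v - sval g v) = 0.
    apply: quot_map_ker; apply/memv_imgP.
    by exists v; rewrite ?memvf // add_lfunE opp_lfunE.
  by rewrite linearB => /subr0_eq.
move=> Z h E.
have h_ker w : sval h (along (limg (sval f - sval g)) w) = sval h w.
  apply/eqP; rewrite eq_sym -subr_eq0 -linearB.
  have /memv_imgP[v _ ->] := along_sub (limg (sval f - sval g)) w.
  rewrite add_lfunE opp_lfunE linearB subr_eq0; apply/eqP.
  by have := congr1 (fun u : fd_hom V Z => sval u v) E; rewrite /= !comp_lfunE.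
pose t : 'Hom(quotMod sU, Z) := (sval h \o linfun vsval)%VF.
have tE q : t q = sval h (vsval q) by rewrite comp_lfunE lfunE.
have t_eq : fd_equivariant t.
  by move=> b q; rewrite !tE vsval_quot_act h_ker (svalP h).
exists (exist _ t t_eq); split.
  apply: fd_hom_inj; apply/lfunP=> w; rewrite /= comp_lfunE tE vsval_quot_map.
  exact: h_ker.
move=> t' Et'; apply: fd_hom_inj; apply/lfunP=> q; rewrite /= tE -Et' /= comp_lfunE.
by congr (sval t' _); apply: subvs_inj; rewrite vsval_quot_map along_id ?subvsP.
Qed.

Lemma fd_op_coequalizers : has_coequalizers (opCat (fdModCat A)).
Proof.
move=> W V f g; have sU := lker_stable (sub_equivariant f g).
exists (subMod sU), (sub_incl sU); split.
  apply: fd_hom_inj; apply/lfunP=> u; rewrite /= !comp_lfunE lfunE /=.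
  exact/eqlfunP/subvsP.
move=> Z h E.
have h_in z : sval h z \in lker (sval f - sval g).
  apply/eqlfunP; have := congr1 (fun u : fd_hom Z W => sval u z) E.
  by rewrite /= !comp_lfunE.
pose t : 'Hom(Z, subMod sU) := (linfun (vsproj _) \o sval h)%VF.
have tE z : vsval (t z) = sval h z by rewrite comp_lfunE lfunE /= vsprojK.
have t_eq : fd_equivariant t.
  by move=> b z; apply: subvs_inj; rewrite vsval_sub_act // !tE (svalP h).
exists (exist _ t t_eq); split.
  by apply: fd_hom_inj; apply/lfunP=> z; rewrite /= comp_lfunE lfunE; apply: tE.
move=> t' Et'; apply: fd_hom_inj; apply/lfunP=> z; apply: subvs_inj.
by rewrite /= tE -Et' /= comp_lfunE lfunE.
Qed.

(** A monomorphism is injective by comparison of the inclusion of its kernel with zero, an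
    epimorphism is surjective by comparison of the projection to its cokernel with zero. *)
Lemma fd_balanced : balanced (fdModCat A).
Proof.
move=> V W f Mf Ef.
have ker0 : lker (sval f) == 0%VS.
  pose S := subMod (lker_stable (svalP f)).
  have E : sub_incl (lker_stable (svalP f)) = fd_zero S V.
    apply: (Mf S); apply: fd_hom_inj; apply/lfunP=> u.
    rewrite /= !comp_lfunE lfunE zero_lfunE linear0 /=; apply/eqP.
    by rewrite -memv_ker subvsP.
  rewrite -subv0; apply/subvP=> v Kv; rewrite memv0 -(vsprojK Kv).
  have := congr1 (fun u : fd_hom S V => sval u (vsproj _ v : S)) E.
  by rewrite /= lfunE zero_lfunE => ->.
have img1 w : w \in limg (sval f).
  pose Q := quotMod (limg_stable (svalP f)).
  have E : quot_proj (limg_stable (svalP f)) = fd_zero W Q.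
    apply: (Ef Q); apply: fd_hom_inj; apply/lfunP=> v.
    rewrite /= comp_lfunE [RHS]comp_lfunE zero_lfunE; apply: quot_map_ker.
    exact/memv_img/memvf.
  have := congr1 (fun u : fd_hom W Q => vsval (sval u w)) E.
  rewrite /= vsval_quot_map zero_lfunE linear0 => {}E.
  by have := along_sub (limg (sval f)) w; rewrite E subr0.
have fK : cancel (sval f) (sval f)^-1%VF by apply: lker0_lfunK.
have Kf : cancel (sval f)^-1%VF (sval f) by move=> w; apply: limg_lfunVK.
have inv_eq : fd_equivariant (sval f)^-1%VF.
  by move=> b w; apply: (can_inj fK); rewrite (svalP f) !Kf.
exists (exist _ _ inv_eq).
by split; apply: fd_hom_inj; apply/lfunP=> v; rewrite /= comp_lfunE id_lfunE ?fK ?Kf.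
Qed.
End FiniteDimensionalModules.

(** * Objects realizing a module category by their internal endomorphisms *)

Lemma finite_coequalizers (k : fieldType) (M : Cat) : is_finite k M -> has_coequalizers M.
Proof.
by move=> [L [A [F [E _]]]]; apply: (equivalence_coequalizers E); apply: fd_coequalizers.
Qed.

Lemma finite_balanced (k : fieldType) (M : Cat) : is_finite k M -> balanced M.
Proof. by move=> [L [A [F [E _]]]]; apply: (equivalence_balanced E); apply: fd_balanced. Qed.

Lemma finite_op_coequalizers (k : fieldType) (M : Cat) :
  is_finite k M -> has_coequalizers (opCat M).
Proof.
move=> [L [A [F [E _]]]]; apply: (equivalence_coequalizers (opFun_equivalence E)).
exact: fd_op_coequalizers.
Qed.

Lemma op_balanced (M : Cat) : balanced M -> balanced (opCat M).
Proof. by move=> bM x y f Mf Ef; have [g [gf fg]] := bM y x f Ef Mf; exists g. Qed.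

(** The comparison functor sends [m] to the regular module of [Hom(m, m)], so that one
    direction is an instance of [algebra_object_in_hat]. *)
Lemma comparison_equivalenceP (C : Cat) (V : Monoidal C) (M : Cat) (a : Action V M)
    (iH : forall m : M, RightAdjoint (actR a m)) (m : M) :
  (forall y : C, has_right_adjoint (actR (regAction V) y)) ->
  has_coequalizers M -> balanced M ->
  is_module_equivalence (comparison_lax iH m) <-> in_hat_tens iH m /\ is_generator a m.
Proof.
move=> RV coM baM; split=> [[E Ss] | [mh mg]]; last exact: comparison_module_equivalence.
exact: (algebra_object_in_hat E Ss iH (idIso (regMod (iEnd iH m) : modCat _)) (RV _)).
Qed.

Lemma unopFun_equivalence (C D : Cat) (F : Functor (opCat C) D) :
  is_equivalence (unopFun F) <-> is_equivalence F.
Proof.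
split=> E; apply: ff_eso_equivalence => [x y f g | x y | d].
- exact: (equivalence_faithful E).
- exact: (equivalence_full E).
- by have [c [i]] := equivalence_ess_surj E d; exists c; constructor; apply: (iso_unop i).
- exact: (equivalence_faithful E).
- exact: (equivalence_full E).
- by have [c [i]] := equivalence_ess_surj E d; exists c; constructor; apply: (iso_op i).
Qed.

Lemma is_iso_op (C : Cat) (x y : C) (f : hom x y) :
  @is_iso C x y f <-> @is_iso (opCat C) y x f.
Proof. by split; case=> g [gf fg]; exists g. Qed.

(** This is [comparison_equivalenceP] for the opposite module category. *)
Lemma cocomparison_equivalenceP (C : Cat) (W : Monoidal C) (M : Cat) (b : Action W M)
    (cH : forall m : M, LeftAdjoint (actR b m)) (n : M) :
  (forall y : opCat C, has_right_adjoint (actR (regAction (opMon W)) y)) ->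
  has_coequalizers (opCat M) -> balanced (opCat M) ->
  is_oplax_module_equivalence (cocomparison_oplax cH n) <->
  in_hat_odot cH n /\ is_cogenerator b n.
Proof.
move=> RW coM baM.
have := @comparison_equivalenceP _ _ _ (opAction b) (opH cH) n RW coM baM.
have -> : is_generator (opAction b) (n : opCat M) <-> is_cogenerator b n by [].
have -> : in_hat_tens (opH cH) n <-> in_hat_odot cH n.
  (* The two functors have the same values; only the proofs of functoriality differ. *)
  pose H := ihomF (opH cH) n; pose H' := opFun (cohomF cH n).
  have nat x y (f : @hom (opCat M) x y) : idIso (H' y) ∘ fmap H f = fmap H' f ∘ idIso (H x).
    by rewrite comp1m compm1.
  have nat' x y (f : @hom (opCat M) x y) : idIso (H y) ∘ fmap H' f = fmap H f ∘ idIso (H' x).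
    by rewrite comp1m compm1.
  split; case=> Ss R; split; try by move=> c m; apply/is_iso_op; apply: Ss.
    exact: (has_right_adjoint_natiso (@Build_NatIso _ _ H H' (fun x => idIso (H x)) nat)).
  exact: (has_right_adjoint_natiso (@Build_NatIso _ _ H' H (fun x => idIso (H x)) nat')).
move=> <-; split; case=> /unopFun_equivalence E Ss; split=> // c m; apply/is_iso_op.
  exact: Ss.
exact: Ss.
Qed.

Theorem theorem4p30 (k : fieldType) (C : GVCat)
    (M : Cat) (a : Action (gv_mon C) M) (hM : is_GV_module a)
    (R : forall c : C, RightAdjoint (actF a (gvG c)))
    (iH : forall m : M, RightAdjoint (actR a m))
    (cH : forall m : M, LeftAdjoint (actR (blackAction R) m)) :
  [/\ algebraic a -> exists m : M, in_hat_tens iH m /\ is_generator a m,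
      is_abelian M ->
        (exists m : M, in_hat_tens iH m /\ is_generator a m) -> algebraic a,
      (exists m : M, in_hat_tens iH m /\ is_generator a m) ->
        (exists x : M, ~ is_zero x) ->
        exists m : M, in_hat_tens iH m /\ ~ is_zero m
    & is_finite k C -> is_finite k M ->
        (forall m : M, is_module_equivalence (comparison_lax iH m) <->
           in_hat_tens iH m /\ is_generator a m) /\
        (forall n : M, is_oplax_module_equivalence (cocomparison_oplax cH n) <->
           in_hat_odot cH n /\ is_cogenerator (blackAction R) n)].
Proof.
split.
- move=> [A [_ [F [S [E Ss]]]]].
  have [m [phi]] := equivalence_ess_surj E (regMod A).
  exists m; apply: (algebra_object_in_hat E Ss iH phi); exact: tens_left_closed.
- move=> abM [m [mh mg]]; exists (iEnd iH m).
  have E := comparison_module_equivalence (abelian_coequalizers abM)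
    (abelian_balanced abM) mh mg.
  split; first exact: (module_equivalence_GV E).
  by exists (comparison iH m), (comparison_lax iH m).
- move=> [m [mh mg]] [x nx]; exists m; split=> // m0; apply: nx.
  exact: (zero_generator hM.1 mg m0).
move=> _ fM; split=> [m | n].
  apply: comparison_equivalenceP; first exact: tens_left_closed.
    exact: finite_coequalizers fM.
  exact: finite_balanced fM.
apply: cocomparison_equivalenceP; first exact: odot_closed.
  exact: finite_op_coequalizers fM.
exact/op_balanced/(finite_balanced fM).
Qed.
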